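(* Let $(H,\|\cdot\|_H,\langle\cdot,\cdot\rangle_H)$ be a separable real Hilbert space with more than one element, let $\mathbb B\subseteq H$ be an orthonormal basis of $H$, let $(\Omega,\mathcal F,\mathbb P)$ be a probability space, let $T\in(0,\infty)$, $\eta,\delta\in\mathbb R$, let $\lambda\colon\mathbb B\to\mathbb R$ be a function which satisfies $\sup_{b\in\mathbb B}(-\lambda_b)<\eta$, let $A\colon D(A)\subseteq H\to H$ be the linear operator with $D(A)=\{v\in H\colon\sum_{b\in\mathbb B}|\lambda_b\langle b,v\rangle_H|^2<\infty\}$ and $Av=-\sum_{b\in\mathbb B}\lambda_b\langle b,v\rangle_Hb$ for all $v\in D(A)$, let $(H_r,\|\cdot\|_{H_r},\langle\cdot,\cdot\rangle_{H_r})$, $r\in\mathbb R$, be a family of interpolation spaces associated to $\eta-A$, let $w\in H$, $b_0\in\mathbb B$, let $\xi\colon\Omega\to H_\delta$ be $\mathcal F/\mathcal B(H_\delta)$-measurable, let $F\colon H\to H$ be continuous, and assume for all $v\in H$ that $\langle b_0,w\rangle_H>0$, $w=\langle b_0,w\rangle_Hb_0$, and $F(v)=\|v\|_Hw$. Let $X\colon[0,T]\times\Omega\to H_\delta$ be $(\mathcal B([0,T])\otimes\mathcal F)/\mathcal B(H_\delta)$-measurable and satisfy for all $t\in(0,T]$ that $X((0,T]\times\Omega)\subseteq H$, $\mathbb P$-a.s. that $\int_0^t\|e^{(t-s)A}F(X_s)\|_{H_\delta}\,ds<\infty$, and $\mathbb P$-a.s. that $X_t=e^{tA}\xi+\int_0^te^{(t-s)A}F(X_s)\,ds$.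 Then for all $t\in(0,T]$ it holds that $\mathbb P(\xi\in H_{-1})=1$ and $\mathbb P$-a.s. that $$\langle b_0,w\rangle_H\,e^{-(\lambda_{b_0}+|\eta|)t}\,\Big[1-e^{-(\inf_{b\in\mathbb B}\lambda_b+\eta)t}\Big]\,\big\|\xi-\langle b_0,\xi\rangle_Hb_0\big\|_{H_{-1}}\le\langle b_0,X_t-e^{tA}\xi\rangle_H\le\|X_t-e^{tA}\xi\|_H<\infty.$$
   Context: Interpolation spaces associated to $\eta-A$: for $r\ge0$, $H_r=D((\eta-A)^r)$ with $\|v\|_{H_r}=\|(\eta-A)^rv\|_H$; for $r<0$, $H_r$ is the completion of $H$ with respect to $\|v\|_{H_r}=\|(\eta-A)^rv\|_H$; the semigroup operators $e^{tA}$ are extended to the spaces $H_r$ in the usual way. The spaces are nested ($H_r\subseteq H_{r'}$ for $r\ge r'$). For $b\in\mathbb B$ (an eigenvector of $A$) the functional $\langle b,\cdot\rangle_H$ is extended continuously to $H_r$ for $r<0$. In time integrals the value of the integrand at time $0$ is irrelevant. *)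

(* Defs.v *)
From HB Require Import structures.
From mathcomp Require Import all_boot all_order all_algebra.
From mathcomp Require Import all_classical all_reals all_analysis.

Set Implicit Arguments.
Unset Strict Implicit.
Unset Printing Implicit Defensive.

Import Order.TTheory GRing.Theory Num.Theory.
Import numFieldNormedType.Exports.

Local Open Scope classical_set_scope.
Local Open Scope ring_scope.

HB.mixin Record CompleteNormedModule_isHilbert (R : realType) H
    of CompleteNormedModule R H := {
  hdot : {dot H for idfun};
  hdotE : forall u : H, hdot u u = `|u| ^+ 2
}.

#[short(type="hilbertType")]
HB.structure Definition Hilbert (R : realType) :=
  {H of CompleteNormedModule R H & CompleteNormedModule_isHilbert R H}.

Definition separable (T : topologicalType) : Prop :=
  exists2 D : set T, countable D & dense D.

Definition borel_type (T : ptopologicalType) := g_sigma_algebraType (@open T).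

Definition has_sum (R : realType) (V : normedModType R) (I : choiceType)
    (B : set I) (f : I -> V) (l : V) : Prop :=
  forall e : R, 0 < e -> exists2 A0 : set I, fsets B A0 &
    forall A : set I, fsets B A -> A0 `<=` A ->
      `|l - \sum_(i \in A) f i| < e.

Definition usum (R : realType) (V : normedModType R) (I : choiceType)
    (B : set I) (f : I -> V) : V :=
  xget 0 [set l | has_sum B f l].

Section bochner.
Context d (T : measurableType d) (R : realType) (V : normedModType R).
Implicit Types (mu : {measure set T -> \bar R}) (D : set T) (f : T -> V).

Definition simple_on mu D f : Prop :=
  [/\ finite_set (f @` D),
      forall y, measurable (D `&` f @^-1` [set y]) &
      forall y, y != 0 -> (mu (D `&` f @^-1` [set y]) < +oo)%E].

Definition simple_integral mu D f : V :=
  \sum_(y \in f @` D) fine (mu (D `&` f @^-1` [set y])) *: y.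

(* The almost everywhere convergence makes f strongly measurable; it cannot be
   dropped, since \int of a nonmeasurable function is only a lower integral. *)
Definition has_bochner_integral mu D f (l : V) : Prop :=
  exists g : nat -> T -> V,
    [/\ forall n, simple_on mu D (g n),
        {ae mu, forall x, D x -> g n x @[n --> \oo] --> f x},
        (\int[mu]_(x in D) `|f x - g n x|%:E)%E @[n --> \oo] --> 0%E &
        simple_integral mu D (g n) @[n --> \oo] --> l].

Definition bochner_integral mu D f : V :=
  xget 0 [set l | has_bochner_integral mu D f l].

End bochner.

Section diagonal.
Context (R : realType) (H : hilbertType R).
Implicit Types (B : set H) (S : H -> H) (phi : R -> R).

Definition orthonormal_basis B : Prop :=
  (forall b c, B b -> B c -> hdot b c = (b == c)%:R) /\
  dense [set v | exists (A : set H) (c : H -> R),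
           fsets B A /\ v = \sum_(b \in A) c b *: b].

(* Functional calculus of an operator S that is diagonal in the orthonormal
   basis B; the eigenvalue of S at b is hdot b (S b). *)
Definition diag_dom B S phi : set H :=
  [set v | (\esum_(b in B) (`|phi (hdot b (S b)) * hdot b v| ^+ 2)%:E < +oo)%E].

Definition diag_op B S phi (v : H) : H :=
  usum B (fun b => (phi (hdot b (S b)) * hdot b v) *: b).

Definition frac_dom B S (r : R) : set H := diag_dom B S (fun x => x `^ r).

Definition frac_pow B S (r : R) : H -> H := diag_op B S (fun x => x `^ r).

Definition exp_op B S (t : R) : H -> H := diag_op B S (fun x => expR (t * x)).

End diagonal.

(* Interpolation spaces (H_r), r in R, associated to S. All of them, and H, are
   subspaces of one vector space (e.g. of their union), so that inclusions and
   memberships between them have a meaning: interp_inj r and interp_injH are the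
   inclusion maps. For r < 0, "complete + isometric + dense" says that
   H_r is a completion of (H, ||S^r .||). *)
Record interpolation_family (R : realType) (H : hilbertType R)
    (B : set H) (S : H -> H) := InterpolationFamily {
  interp_ambient : lmodType R;
  interp_space : R -> hilbertType R;
  interp_inj : forall r, {linear interp_space r -> interp_ambient};
  interp_injH : {linear H -> interp_ambient};
  interp_inj_injective : forall r, injective (interp_inj r);
  interp_injH_injective : injective interp_injH;
  interp_ge0 : forall r, 0 <= r ->
    range (interp_inj r) = interp_injH @` frac_dom B S r;
  interp_lt0_sub : forall r, r < 0 ->
    range interp_injH `<=` range (interp_inj r);
  interp_lt0_dense : forall r, r < 0 ->
    dense (interp_inj r @^-1` range interp_injH);
  interp_normE : forall r (x : interp_space r) (v : H),
    interp_inj r x = interp_injH v -> `|x| = `|frac_pow B S r v|;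
  interp_nested : forall r r', r' <= r ->
    range (interp_inj r) `<=` range (interp_inj r');
  interp_nested_continuous : forall r r', r' <= r ->
    exists C : R, forall (x : interp_space r) (y : interp_space r'),
      interp_inj r x = interp_inj r' y -> `|y| <= C * `|x|
}.

Arguments interp_space {R H B S} _ _.
Arguments interp_inj {R H B S} _ _.
Arguments interp_injH {R H B S} _.

(* The norm of the subspace f V, as an extended real: +oo outside f V. *)
Definition norm_along (R : realType) (V : normedModType R) (E : lmodType R)
    (f : V -> E) (x : E) : \bar R :=
  ereal_inf [set `|v|%:E | v in f @^-1` [set x]].

Section interpolation_ops.
Context (R : realType) (H : hilbertType R) (B : set H) (S : H -> H).
Variable (Hs : interpolation_family B S).

(* An element of H_r that lies in H, seen in H (junk value 0 otherwise), and
   conversely. *)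
Definition to_H r (x : interp_space Hs r) : H :=
  xget 0 [set v | interp_injH Hs v = interp_inj Hs r x].

Definition of_H r (v : H) : interp_space Hs r :=
  xget 0 [set x | interp_inj Hs r x = interp_injH Hs v].

(* For r < 0 the continuous extension from H to H_r; for r >= 0 the
   restriction from H to H_r. *)
Definition interp_dot r (b : H) : interp_space Hs r -> R :=
  xget (fun=> 0) [set f | continuous f /\
    forall x v, interp_inj Hs r x = interp_injH Hs v -> f x = hdot b v].

Definition interp_exp (A : H -> H) r (t : R) :
    interp_space Hs r -> interp_space Hs r :=
  xget (fun=> 0) [set f | continuous f /\
    forall x v, interp_inj Hs r x = interp_injH Hs v ->
      interp_inj Hs r (f x) = interp_injH Hs (exp_op B A t v)].

End interpolation_ops.

(* Main.v *)
(** Everything acts along the eigenvector [b0]: since [F v = |v| w] and [w] is a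
    multiple of [b0], the convolution in the mild formulation is the scalar
    [<b0, w> * int_0^t exp (- lambda_b0 (t - s)) |X_s| ds] times [b0], so the
    other coordinates of [X_s] are those of [exp (s A) xi].  With
    [mu_b = eta + lambda_b], the vector with coordinates
    [(1 - exp (- mu_b t)) <b, xi> / mu_b], [b <> b0], is the integral of
    [exp (- eta s) (X_s - <b0, X_s> b0)], and its norm dominates
    [1 - exp (- inf mu t)] times the [H_(-1)] norm of [xi - <b0, xi> b0].  By
    Fubini, almost surely the coordinates agree for almost every [s]; finiteness
    of the convolution then forces [xi] into [H_(-1)].  In each [H_r] the vectors
    [mu_b ^ (- r) b] form an orthonormal basis, which turns all statements about
    extensions and inclusions into statements about coordinates. *)

(* The vector-valued integral of exp (- eta s) (X_s - <b0, X_s> b0) is never formed. It is replaced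
   by duality on finite sets of basis vectors other than b0: the resulting estimate has a constant
   independent of the set, and this uniformity lets Riesz-Fischer produce membership in H_(-1)
   instead of presupposing it. The factor exp (- (lambda_b0 + |eta|) t) comes from comparing two
   weights: exp (- eta s), which turns the rates lambda_b into mu_b, and the convolution kernel exp
   (- lambda_b0 (t - s)). As lambda_b0 + eta > 0, their ratio is at most exp ((lambda_b0 + |eta|) t)
   on (0, t]. Two obstacles shape the rest. The mild equation holds at each time off a null set
   depending on that time, so Fubini is applied to each coordinate separately, and the countability
   of B, obtained from separability, joins the exceptional sets. Moreover the functionals and the
   semigroup on H_r are selected by [xget], so explicit candidates and their uniqueness by density
   precede any computation. *)
Require Import Defs.
From mathcomp Require Import all_boot all_order all_algebra.
From mathcomp Require Import all_classical all_reals all_analysis.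
From mathcomp Require Import measurable_realfun.
From mathcomp Require Import ring lra.

Set Implicit Arguments.
Unset Strict Implicit.
Unset Printing Implicit Defensive.

Import Order.TTheory GRing.Theory Num.Theory.
Import numFieldNormedType.Exports.

Local Open Scope classical_set_scope.
Local Open Scope ring_scope.

(** * Orthonormal families in Hilbert spaces *)

Section hilbert.
Context (R : realType) (K : hilbertType R).
Implicit Types (u v x y : K).

Lemma hdotC u v : hdot u v = hdot v u.
Proof. by rewrite hermC expr0 mul1r. Qed.

Lemma hdotDr u v x : hdot u (v + x) = hdot u v + hdot u x.
Proof. exact: raddfD. Qed.

Lemma hdotBr u v x : hdot u (v - x) = hdot u v - hdot u x.
Proof. exact: raddfB. Qed.

Lemma hdotZr (a : R) u v : hdot u (a *: v) = a * hdot u v.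
Proof. exact: linearZ. Qed.

Lemma hdot0r u : hdot u 0 = 0.
Proof. exact: raddf0. Qed.

Lemma hdotDl u v x : hdot (u + v) x = hdot u x + hdot v x.
Proof. by rewrite !(hdotC _ x) hdotDr. Qed.

Lemma hdotZl (a : R) u v : hdot (a *: u) v = a * hdot u v.
Proof. by rewrite !(hdotC _ v) hdotZr. Qed.

Lemma hdot_sumr (I : choiceType) (A : set I) (f : I -> K) u : finite_set A ->
  hdot u (\sum_(i \in A) f i) = \sum_(i \in A) hdot u (f i).
Proof. by move=> fA; rewrite !fsbig_finite//= raddf_sum. Qed.

(** An interpolation family prescribes only norms on vectors of [H]; polarization recovers the inner
    products of its spaces. *)
Lemma hdot_polar u v : hdot u v = (`|u + v| ^+ 2 - `|u| ^+ 2 - `|v| ^+ 2) / 2.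
Proof. by rewrite -!hdotE hdotDl !hdotDr (hdotC v u); field. Qed.

Lemma hdot_le u v : `|hdot u v| <= `|u| * `|v|.
Proof.
have [->|u0] := eqVneq u 0; first by rewrite hdotC hdot0r normr0 normr0 mul0r.
have uu : 0 < hdot u u by rewrite hdotE exprn_gt0// normr_gt0.
(* With the abbreviations below, this square expands to [a * (a * c - b ^+ 2)], and [a] is
   positive. *)
have := sqr_ge0 `|hdot u u *: v - hdot u v *: u|.
rewrite -hdotE hdotBr !hdotZr !(hdotC (_ - _)) !hdotBr !hdotZr.
rewrite (hdotC v u).
set a := hdot u u; set b := hdot u v; set c := hdot v v => h.
have {}h : b ^+ 2 <= a * c.
  have : 0 <= a * (a * c - b ^+ 2) by move: h; congr (_ <= _); ring.
  by rewrite pmulr_rge0// subr_ge0.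
rewrite -(@ler_pXn2r _ 2)// ?nnegrE ?mulr_ge0//.
by rewrite -normrX ger0_norm ?sqr_ge0// exprMn -!hdotE.
Qed.

Lemma hdot_continuous u : continuous (hdot u : K -> R).
Proof.
move=> x; apply/cvgrPdist_lt => e e0.
near=> y.
rewrite -hdotBr; apply: le_lt_trans (hdot_le _ _) _.
have : `|x - y| < e / (`|u| + 1).
  by near: y; apply: cvgr_dist_lt; rewrite ?divr_gt0// ltr_wpDl.
rewrite ltr_pdivlMr ?ltr_wpDl// => h; apply: le_lt_trans h.
by rewrite mulrC ler_wpM2l// lerDl.
Unshelve. all: by end_near. Qed.

Lemma hdot_inj u v : (forall x, hdot x u = hdot x v) -> u = v.
Proof.
move=> h; apply/eqP; rewrite -subr_eq0 -normr_eq0 -sqrf_eq0 -hdotE.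
by rewrite hdotBr h subrr.
Qed.

Lemma norm_le_of_sqr (a b : R) : 0 <= b -> a ^+ 2 <= b * a -> a <= b.
Proof.
move=> b0; have [a0 _|a0] := leP a 0; first exact: le_trans a0 b0.
by rewrite expr2 ler_pM2r.
Qed.

End hilbert.

Lemma dense_normP (R : realType) (V : normedModType R) (D : set V) : dense D <->
  forall x e, 0 < e -> exists2 y, D y & `|x - y| < e.
Proof.
split=> [dD x e e0|h O [x Ox] oO].
  have [y [xy Dy]] : (ball x e `&` D) !=set0.
      by apply: dD; [exists x; exact: ballxx|exact: ball_open].
  by exists y => //; move: xy; rewrite -ball_normE.
have /nbhs_ballP[e e0 eO] : nbhs x O by exact: open_nbhs_nbhs.
have [y Dy xy] := h x e e0.
by exists y; split=> //; apply: eO; rewrite -ball_normE.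
Qed.

(** The source of uniqueness for the continuous extensions that [interp_dot] and [interp_exp] select
    by [xget]. *)
Lemma continuous_eq_dense (T U : topologicalType) (D : set T)
    (f g : T -> U) : hausdorff_space U -> dense D ->
  continuous f -> continuous g -> (forall x, D x -> f x = g x) -> f = g.
Proof.
move=> hU dD cf cg fg; apply/funext => x; apply: hU => P Q /cf fP /cg gQ.

have : nbhs x (f @^-1` P `&` g @^-1` Q) by exact: filterI.
rewrite nbhsE => -[W [oW Wx] WPQ].
have [y [Wy Dy]] : (W `&` D) !=set0 by apply: dD => //; exists x.
by have [Py Qy] := WPQ _ Wy; exists (f y); split=> //; rewrite fg.
Qed.

(** * Bessel, Riesz-Fischer and Parseval, stated for an indexed family so as to serve both [B]
    itself and the rescaled bases of the spaces H_r *)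

Section orthonormal.
Context (R : realType) (K : hilbertType R) (I : choiceType).
Context (B : set I) (e : I -> K).
Hypothesis one : forall b c, B b -> B c -> hdot (e b) (e c) = (b == c)%:R.
Implicit Types (A : set I) (c : I -> R).

Lemma orthonormal_dot_sum A c b : fsets B A -> B b ->
  hdot (e b) (\sum_(a \in A) c a *: e a) = (b \in A)%:R * c b.
Proof.
move=> [fA AB] Bb; rewrite hdot_sumr//.
under eq_fsbigr do rewrite hdotZr.
have [bA|bA] := boolP (b \in A).
  rewrite (fsbigD1 b)//=; last by rewrite inE in bA.
  rewrite fsbig1 ?addr0 => [|i [Ai /= /eqP ib]].
    by rewrite one// eqxx mulr1 mul1r.
  by have Bi := AB _ Ai; rewrite one// eq_sym (negbTE ib) mulr0.
rewrite mul0r fsbig1// => i Ai; have Bi := AB _ Ai; rewrite one//.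
by case: (eqVneq b i) => [bi|_]; rewrite ?mulr0// bi mem_set in bA *.
Qed.

Lemma orthonormal_norm_sum A c : fsets B A ->
  `|\sum_(a \in A) c a *: e a| ^+ 2 = \sum_(a \in A) c a ^+ 2.
Proof.
move=> BA; have [fA AB] := BA.
rewrite -hdotE hdot_sumr//; apply: eq_fsbigr => i iA.
rewrite hdotZr hdotC orthonormal_dot_sum ?iA ?mul1r//.
by apply: AB; rewrite inE in iA.
Qed.

Lemma bessel A x : fsets B A -> \sum_(a \in A) hdot (e a) x ^+ 2 <= `|x| ^+ 2.
Proof.
move=> BA; have [fA AB] := BA.
set s := \sum_(a \in A) _; set y := \sum_(a \in A) hdot (e a) x *: e a.
have yx : hdot x y = s.
  by rewrite hdot_sumr//; apply: eq_fsbigr => i _; rewrite hdotZr hdotC.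
have := sqr_ge0 `|x - y|.
rewrite -hdotE hdotBr !(hdotC (x - y)) !hdotBr (hdotC y x) yx !hdotE.
rewrite (orthonormal_norm_sum _ BA) -/s; lra.
Qed.

Lemma has_sum_dot c l b : has_sum B (fun a => c a *: e a) l -> B b ->
  hdot (e b) l = c b.
Proof.
move=> hl Bb; apply/eqP; rewrite -subr_eq0 -normr_le0; apply/ler_addgt0Pl => d d0.
rewrite addr0; have [A0 [fA0 A0B] h] := hl _ d0.
have BA : fsets B (A0 `|` [set b]).
  split; first by rewrite finite_setU; split.
  by move=> i [/A0B//|->].
have := h _ BA (@subsetUl _ _ _).
have <- : hdot (e b) (\sum_(a \in A0 `|` [set b]) c a *: e a) = c b.
  by rewrite orthonormal_dot_sum// mem_set ?mul1r//; right.
move=> /ltW h'; rewrite -hdotBr; apply: le_trans (hdot_le _ _) _.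
have -> : `|e b| = 1.
  apply/eqP; rewrite -(@pexpr_eq1 _ _ 2)//.
  by rewrite -hdotE one// eqxx.
by rewrite mul1r.
Qed.

Lemma has_sum_norm c l M : has_sum B (fun a => c a *: e a) l ->
  (forall A, fsets B A -> \sum_(a \in A) c a ^+ 2 <= M ^+ 2) -> 0 <= M -> `|l| <= M.
Proof.
move=> hl hM M0; apply/ler_addgt0Pl => d d0.
have [A0 BA0 h] := hl _ d0.
have := h _ BA0 (@subset_refl _ _).
have : `|\sum_(a \in A0) c a *: e a| <= M.
  by rewrite -(@ler_pXn2r _ 2)// ?nnegrE// orthonormal_norm_sum// hM.
set y := \sum_(a \in _) _ => yM ly.
rewrite -(subrK y l); apply: le_trans (ler_normD _ _) _.
by rewrite lerD// ltW.
Qed.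

(** The net of finite partial sums, encoded as a filter so that completeness of [K] applies to
    unordered sums. *)
Let partial_sums (f : I -> K) : set_system K :=
  [set P | exists2 A0, fsets B A0 &
    forall A, fsets B A -> A0 `<=` A -> P (\sum_(a \in A) f a)].

Let partial_sums_proper f : ProperFilter (partial_sums f).
Proof.
split.
  by move=> [A BA h]; exact: h BA (@subset_refl _ _).
split.
- by exists set0 => //; split; [exact: finite_set0|exact: sub0set].
- move=> P Q [A [fA AB] hA] [A' [fA' A'B] hA']; exists (A `|` A').
    by split; [rewrite finite_setU|rewrite subUset].
  by move=> C BC; rewrite subUset => - [AC A'C]; split; [exact: hA|exact: hA'].
- by move=> P Q PQ [A BA h]; exists A => // C BC AC; apply/PQ/h.
Qed.

Lemma riesz_fischer c M :
  (forall A, fsets B A -> \sum_(a \in A) c a ^+ 2 <= M) ->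
  exists l, has_sum B (fun a => c a *: e a) l.
Proof.
move=> hM; set f := fun a => c a *: e a.
pose S := [set \sum_(a \in A) c a ^+ 2 | A in fsets B].
have hS : has_sup S.
  split; last by exists M => _ [A BA <-]; exact: hM.
  exists 0, set0; last by rewrite fsbig_set0.
  by split; [exact: finite_set0|exact: sub0set].
have FP : ProperFilter (partial_sums f) := partial_sums_proper f.
have : cvg (partial_sums f).
  apply: cauchy_cvg; apply/cauchy_exP => d d0.
  have d2 : 0 < d ^+ 2 by rewrite exprn_gt0.
  (* Once the squares over [A0] are within [d ^+ 2] of their supremum, whatever a larger finite set
     adds has norm below [d]. *)
  have [_ [A0 BA0 <-] hA0] := sup_adherent d2 hS.
  exists (\sum_(a \in A0) f a); exists A0 => // A BA A0A.
  rewrite -ball_normE /ball_/= distrC.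
  have [fA AB] := BA.
  have BD : fsets B (A `\` A0).
    by split; [exact: finite_setD|move=> i [/AB]].
  have E : forall (V : zmodType) (g : I -> V), \sum_(a \in A) g a - \sum_(a \in A0) g a =
      \sum_(a \in A `\` A0) g a.
    move=> V g; rewrite (fsbigID A0)// (_ : A `&` A0 = A0); last exact: setIidr.
    by rewrite addrC addKr.
  rewrite E -(@ltr_pXn2r _ 2)// ?nnegrE ?normr_ge0 ?ltW//.
  rewrite orthonormal_norm_sum// -E ltrBlDl.
  have : \sum_(a \in A) c a ^+ 2 <= sup S by apply: sup_ubound; [case: hS|exists A].
  by move=> h; apply: le_lt_trans h _; rewrite -ltrBlDr.
move=> cv; exists (lim (partial_sums f)) => d d0.
have [A BA h] : partial_sums f (ball (lim (partial_sums f)) d).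
  exact/cv/nbhsx_ballx.
by exists A => // C BC AC; have := h _ BC AC; rewrite -ball_normE.
Qed.

Hypothesis total : forall x, (forall b, B b -> hdot (e b) x = 0) -> x = 0.

Lemma total_inj x y : (forall b, B b -> hdot (e b) x = hdot (e b) y) -> x = y.
Proof.
by move=> h; apply/subr0_eq/total => b Bb; rewrite hdotBr h// subrr.
Qed.

Lemma riesz_fischer_coord c M :
  (forall A, fsets B A -> \sum_(a \in A) c a ^+ 2 <= M) ->
  exists x, forall b, B b -> hdot (e b) x = c b.
Proof. by move=> /riesz_fischer[l hl]; exists l => b Bb; exact: has_sum_dot. Qed.

Lemma has_sum_total c l : has_sum B (fun a => c a *: e a) l ->
  usum B (fun a => c a *: e a) = l.
Proof.
move=> hl; rewrite /usum; case: xgetP => [y _ hy|/(_ l)//].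
by apply: total_inj => b Bb; rewrite (has_sum_dot hl)// (has_sum_dot hy).
Qed.

Lemma usum_dot c M b : (forall A, fsets B A -> \sum_(a \in A) c a ^+ 2 <= M) ->
  B b -> hdot (e b) (usum B (fun a => c a *: e a)) = c b.
Proof.
move=> /riesz_fischer[l hl] Bb.
by rewrite (has_sum_total hl) (has_sum_dot hl).
Qed.

(** The coordinates of [x] are square summable, so they have a sum [l]; totality forces [x = l], and
    [l] is a limit of vectors of norm at most [M]. *)
Lemma parseval_le x M : 0 <= M ->
  (forall A, fsets B A -> \sum_(a \in A) hdot (e a) x ^+ 2 <= M ^+ 2) -> `|x| <= M.
Proof.
move=> M0 hM; have [l hl] := riesz_fischer hM.
rewrite (_ : x = l); first exact: has_sum_norm hl hM M0.
by apply: total_inj => b Bb; rewrite (has_sum_dot hl).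
Qed.

Lemma parseval x :
  (`|x| ^+ 2)%:E = \esum_(a in B) (hdot (e a) x ^+ 2)%:E.
Proof.
apply/eqP; rewrite eq_le; apply/andP; split; last first.
  apply: ub_ereal_sup => _ [A BA <-].
  by rewrite fsumEFin ?lee_fin ?bessel//; case: BA.
have : ((0 : R)%:E <= \esum_(a in B) (hdot (e a) x ^+ 2)%:E)%E.
  by apply: esum_ge0 => i _; rewrite lee_fin sqr_ge0.
case E : (esum _ _) => [r| |]; rewrite ?leey// lee_fin => r0.
rewrite lee_fin -[leRHS]sqr_sqrtr// ler_pXn2r ?nnegrE ?sqrtr_ge0//.
apply: parseval_le => [|A BA]; rewrite ?sqrtr_ge0// sqr_sqrtr//.
rewrite -lee_fin -E -fsumEFin; last by case: BA.
by apply: ereal_sup_ubound; exists A.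
Qed.

End orthonormal.

(** * Diagonal operators *)

Lemma esum_ltyP (R : realType) (I : choiceType) (B : set I) (g : I -> R) :
  (\esum_(b in B) (g b)%:E < +oo)%E <->
  exists M, forall A, fsets B A -> \sum_(b \in A) g b <= M.
Proof.
split=> [h|[M hM]]; last first.
  apply: (@le_lt_trans _ _ M%:E); last exact: ltry.
  apply: ub_ereal_sup => _ [A BA <-].
  by rewrite fsumEFin ?lee_fin ?hM//; case: BA.
exists (fine (\esum_(b in B) (g b)%:E)%E) => A BA.
have [fA AB] := BA.
have hA : ((\sum_(b \in A) g b)%:E <= \esum_(b in B) (g b)%:E)%E.
  by rewrite -fsumEFin//; apply: ereal_sup_ubound; exists A.
rewrite -lee_fin fineK// fin_numE -ltey h andbT.
by apply: contraTneq hA => ->.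
Qed.

Section diagonal_operators.
Context (R : realType) (H : hilbertType R) (B : set H).
Hypothesis hB : orthonormal_basis B.
Implicit Types (u v : H) (b : H) (A : set H) (S : H -> H) (phi : R -> R).

Let onB : forall b c, B b -> B c -> hdot (id b) (id c) = (b == c)%:R :> R.
Proof. by case: hB. Qed.

(** The continuous functional [hdot u] vanishes on the dense span of [B], hence also at [u]. *)
Lemma orthonormal_basis_total u : (forall b, B b -> hdot b u = 0) -> u = 0.
Proof.
move=> hu.
have : hdot u = (fun=> 0) :> (H -> R).
  apply: (@continuous_eq_dense _ _ _ _ _ (@norm_hausdorff _ _) hB.2) => //.
  - exact: hdot_continuous.
  - by move=> x; apply: cvg_cst.
  move=> _ [A [c [[fA AB] ->]]]; rewrite hdot_sumr// fsbig1// => b /AB Bb.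
  by rewrite hdotZr hdotC hu ?mulr0.
move=> /(congr1 (fun f => f u)); rewrite hdotE => /eqP.
by rewrite sqrf_eq0 normr_eq0 => /eqP.
Qed.

Let totB := orthonormal_basis_total.

Lemma diag_op_dot S phi v b : diag_dom B S phi v -> B b ->
  hdot b (diag_op B S phi v) = phi (hdot b (S b)) * hdot b v.
Proof.
move=> /esum_ltyP[M hM] Bb.
apply: (usum_dot (e := id) onB totB (M := M)
  (c := fun b => phi (hdot b (S b)) * hdot b v)) => // A BA.
by apply: le_trans (hM A BA); under [leRHS]eq_fsbigr do rewrite real_normK ?num_real//.
Qed.

Lemma diag_dom_bounded S phi v C : (forall b, B b -> `|phi (hdot b (S b))| <= C) ->
  diag_dom B S phi v.
Proof.
move=> hC; apply/esum_ltyP; exists (C ^+ 2 * `|v| ^+ 2) => A BA.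
have [fA AB] := BA.
apply: (@le_trans _ _ (C ^+ 2 * \sum_(b \in A) hdot b v ^+ 2)); last first.
  by rewrite ler_wpM2l ?sqr_ge0// (bessel (e := id) onB).
rewrite !fsbig_finite// mulr_sumr big_seq [leRHS]big_seq ler_sum// => b.
rewrite in_fset_set// inE => /AB Bb.
rewrite normrM exprMn [X in _ * X]real_normK ?num_real//.
rewrite ler_wpM2r ?sqr_ge0//.
have hb := hC _ Bb; rewrite ler_pXn2r// nnegrE//; exact: le_trans hb.
Qed.

Lemma diag_op_norm_le S phi v C : 0 <= C ->
  (forall b, B b -> `|phi (hdot b (S b))| <= C) ->
  `|diag_op B S phi v| <= C * `|v|.
Proof.
move=> C0 hC.
apply: (parseval_le (e := id) onB totB); first by rewrite mulr_ge0.
move=> A BA; have [fA AB] := BA.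
apply: (@le_trans _ _ (C ^+ 2 * \sum_(b \in A) hdot b v ^+ 2)); last first.
  by rewrite exprMn ler_wpM2l ?sqr_ge0// (bessel (e := id) onB).
rewrite !fsbig_finite// mulr_sumr big_seq [leRHS]big_seq ler_sum// => b.
rewrite in_fset_set// inE => /AB Bb.
rewrite diag_op_dot//; last exact: diag_dom_bounded hC.
rewrite exprMn ler_wpM2r ?sqr_ge0// -(real_normK (num_real _)).
by rewrite ler_pXn2r// hC.
Qed.

Lemma diag_dom_basis S phi b : B b -> diag_dom B S phi b.
Proof.
move=> Bb; apply/esum_ltyP; exists (`|phi (hdot b (S b)) *: b| ^+ 2) => A BA.
apply: le_trans (bessel (e := id) onB _ BA); have [fA AB] := BA.
rewrite le_eqVlt; apply/orP; left; apply/eqP/eq_fsbigr => a aA.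
rewrite real_normK ?num_real//= hdotZr.
have Ba : B a by apply: AB; rewrite inE in aA.
rewrite [hdot a b]onB//; have [->//|_] := eqVneq a b.
by rewrite !mulr0.
Qed.

Lemma diag_op_basis S phi b : B b ->
  diag_op B S phi b = phi (hdot b (S b)) *: b.
Proof.
move=> Bb; apply: (total_inj (e := id) totB) => a Ba /=.
rewrite diag_op_dot//; last exact: diag_dom_basis.
rewrite hdotZr [hdot a b]onB//; have [->//|_] := eqVneq a b.
by rewrite !mulr0.
Qed.

Lemma diag_domZ S phi (k : R) v : diag_dom B S phi v -> diag_dom B S phi (k *: v).
Proof.
move=> /esum_ltyP[M hM]; apply/esum_ltyP; exists (k ^+ 2 * M) => A BA.
have [fA AB] := BA; apply: le_trans (ler_wpM2l (sqr_ge0 _) (hM A BA)).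
rewrite !fsbig_finite// mulr_sumr ler_sum// => b _.
by rewrite !real_normK ?num_real// hdotZr mulrCA exprMn.
Qed.

Lemma diag_opZ S phi (k : R) v : diag_dom B S phi v ->
  diag_op B S phi (k *: v) = k *: diag_op B S phi v.
Proof.
move=> dv; apply: (total_inj (e := id) totB) => a Ba /=.
by rewrite hdotZr !diag_op_dot//; [rewrite hdotZr mulrCA|exact: diag_domZ].
Qed.

Lemma diag_domD S phi u v : diag_dom B S phi u -> diag_dom B S phi v ->
  diag_dom B S phi (u + v).
Proof.
move=> /esum_ltyP[M hM] /esum_ltyP[N hN]; apply/esum_ltyP.
exists (2 * (M + N)) => A BA; have [fA AB] := BA.
apply: (le_trans _ (ler_wpM2l (ler0n _ 2) (lerD (hM A BA) (hN A BA)))).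
rewrite !fsbig_finite// -big_split/= mulr_sumr ler_sum// => b _.
rewrite !real_normK ?num_real// hdotDr mulrDr.
set x := _ * _; set y := _ * _; have := sqr_ge0 (x - y); lra.
Qed.

Lemma diag_opD S phi u v : diag_dom B S phi u -> diag_dom B S phi v ->
  diag_op B S phi (u + v) = diag_op B S phi u + diag_op B S phi v.
Proof.
move=> du dv; apply: (total_inj (e := id) totB) => a Ba /=.
by rewrite hdotDr !diag_op_dot//; [rewrite hdotDr mulrDr|exact: diag_domD].
Qed.

End diagonal_operators.

(** * Coordinates in the interpolation spaces *)

Section interpolation_coordinates.
Context (R : realType) (H : hilbertType R) (B : set H) (S : H -> H).
Hypothesis hB : orthonormal_basis B.
Variable (eps : R).
Hypothesis eps_gt0 : 0 < eps.
Hypothesis eps_le : forall b, B b -> eps <= hdot b (S b).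
Context (Hs : interpolation_family B S).
Implicit Types (r : R) (b : H) (u v : H).

Let onB : forall b c, B b -> B c -> hdot (id b) (id c) = (b == c)%:R :> R.
Proof. by case: hB. Qed.

Let totB := orthonormal_basis_total hB.

Let mu b := hdot b (S b).

Let mu_gt0 b : B b -> 0 < mu b.
Proof. by move=> /eps_le; exact: lt_le_trans. Qed.

Let wt r b := mu b `^ r.

Let wt_gt0 r b : B b -> 0 < wt r b.
Proof. by move=> /mu_gt0; exact: powR_gt0. Qed.

Let wt_neq0 r b : B b -> wt r b != 0.
Proof. by move=> /(wt_gt0 r); rewrite lt0r => /andP[]. Qed.

(** The spectral gap [eps] makes negative powers of [S] bounded, so that for r < 0 their domain is
    all of [H]. *)
Lemma powR_neg_le r b : r < 0 -> B b -> `|hdot b (S b) `^ r| <= eps `^ r.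
Proof.
move=> r0 Bb; rewrite ger0_norm ?powR_ge0//.
rewrite -(opprK r) !(powRN _ (- r)) lef_pV2 ?posrE ?powR_gt0 ?(mu_gt0 Bb)//.
rewrite ge0_ler_powR ?nnegrE ?oppr_ge0 ?(ltW r0) ?(ltW eps_gt0)//.
  by rewrite ltW// (mu_gt0 Bb).
exact: eps_le.
Qed.

(** Together with the next lemma this treats both signs of [r] at once: a vector of [H] belongs to
    H_r exactly when it is in [frac_dom B S r]. *)
Lemma frac_dom_of_interp r (x : interp_space Hs r) v :
  interp_inj Hs r x = interp_injH Hs v -> frac_dom B S r v.
Proof.
move=> xv; have [r0|r0] := ltP r 0.
  by apply: (diag_dom_bounded hB) => b; exact: powR_neg_le r0.
have : range (interp_inj Hs r) (interp_inj Hs r x) by exists x.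
rewrite (interp_ge0 _ r0) xv => -[u du /(@interp_injH_injective _ _ _ _ Hs)].
by move=> <-.
Qed.

Lemma interp_of_frac_dom r v : frac_dom B S r v ->
  exists x : interp_space Hs r, interp_inj Hs r x = interp_injH Hs v.
Proof.
move=> dv; have [r0|r0] := ltP r 0.
  have : range (interp_injH Hs) (interp_injH Hs v) by exists v.
  by move=> /(interp_lt0_sub r0)[x _ <-]; exists x.
have : (interp_injH Hs @` frac_dom B S r) (interp_injH Hs v) by exists v.
by rewrite -(interp_ge0 _ r0) => -[x _ <-]; exists x.
Qed.

Lemma of_HE r v : frac_dom B S r v ->
  interp_inj Hs r (of_H Hs r v) = interp_injH Hs v.
Proof.
move=> /interp_of_frac_dom[x xv]; rewrite /of_H.
by case: xgetP => [y _ //|/(_ x)].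
Qed.

Lemma of_H_unique r (x : interp_space Hs r) v :
  interp_inj Hs r x = interp_injH Hs v -> of_H Hs r v = x.
Proof.
move=> xv; apply: (@interp_inj_injective _ _ _ _ Hs r).
by rewrite of_HE//; exact: frac_dom_of_interp xv.
Qed.

Lemma to_HE r (x : interp_space Hs r) v :
  interp_inj Hs r x = interp_injH Hs v -> to_H x = v.
Proof.
move=> xv; rewrite /to_H; case: xgetP => [u _ /= uv|/(_ v)/(_ (esym xv))//].
by apply: (@interp_injH_injective _ _ _ _ Hs); rewrite uv.
Qed.

Lemma interp_dense r : dense (interp_inj Hs r @^-1` range (interp_injH Hs)).
Proof.
have [r0|r0] := ltP r 0; first exact: interp_lt0_dense.
apply/dense_normP => x e e0; exists x; last by rewrite subrr normr0.
have : range (interp_inj Hs r) (interp_inj Hs r x) by exists x.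
by rewrite (interp_ge0 _ r0) => -[v _ vx]; exists v.
Qed.

Let ib r b : interp_space Hs r := of_H Hs r b.

Let ibE r b : B b -> interp_inj Hs r (ib r b) = interp_injH Hs b.
Proof. by move=> Bb; apply/of_HE/diag_dom_basis. Qed.

Let interp_hdot r (x y : interp_space Hs r) u v :
  interp_inj Hs r x = interp_injH Hs u -> interp_inj Hs r y = interp_injH Hs v ->
  hdot x y = hdot (frac_pow B S r u) (frac_pow B S r v).
Proof.
move=> xu yv; have xyuv : interp_inj Hs r (x + y) = interp_injH Hs (u + v).
  by rewrite !raddfD/= xu yv.
rewrite !hdot_polar (interp_normE xu) (interp_normE yv) (interp_normE xyuv).
by rewrite /frac_pow (diag_opD hB (frac_dom_of_interp xu) (frac_dom_of_interp yv)).
Qed.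

Let ib_hdot r b (y : interp_space Hs r) v : B b ->
  interp_inj Hs r y = interp_injH Hs v ->
  hdot (ib r b) y = wt r b * (wt r b * hdot b v).
Proof.
move=> Bb yv; rewrite (interp_hdot (ibE r Bb) yv) /frac_pow.
rewrite (diag_op_basis hB)// hdotZl (diag_op_dot hB)//.
exact: frac_dom_of_interp yv.
Qed.

Definition interp_basis r b : interp_space Hs r :=
  (hdot b (S b) `^ r)^-1 *: of_H Hs r b.

Lemma interp_basis_hdot r b (y : interp_space Hs r) v : B b ->
  interp_inj Hs r y = interp_injH Hs v ->
  hdot (interp_basis r b) y = hdot b (S b) `^ r * hdot b v.
Proof.
by move=> Bb yv; rewrite hdotZl (ib_hdot Bb yv) mulKf// wt_neq0.
Qed.

Lemma interp_basis_orthonormal r b c : B b -> B c ->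
  hdot (interp_basis r b) (interp_basis r c) = (b == c)%:R.
Proof.
move=> Bb Bc; rewrite {2}/interp_basis hdotZr (interp_basis_hdot Bb (ibE r Bc)).
rewrite [hdot b c]onB//; case: eqVneq => [->|_]; last by rewrite !mulr0.
by rewrite mulr1 mulVf// wt_neq0.
Qed.

(** For r >= 0 the space sits inside [H], where [B] is total. For r < 0 the inclusion [j] of [H] is
    bounded; a vector orthogonal to the basis is orthogonal to [j] of the span of [B], then to the
    range of [j] by density in [H], then to everything by density of that range in H_r. *)
Lemma interp_basis_total r (x : interp_space Hs r) :
  (forall b, B b -> hdot (interp_basis r b) x = 0) -> x = 0.
Proof.
move=> hx; have [r0|r0] := ltP r 0; last first.
  have : range (interp_inj Hs r) (interp_inj Hs r x) by exists x.
  rewrite (interp_ge0 _ r0) => -[v _ /esym xv].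
  suff v0 : v = 0.
    by apply: (@interp_inj_injective _ _ _ _ Hs r); rewrite xv v0 !raddf0.
  apply: totB => b Bb; have := hx _ Bb.
  rewrite (interp_basis_hdot Bb xv) => /eqP.
  by rewrite mulf_eq0 (negbTE (wt_neq0 _ Bb)) => /eqP.
have dr v : frac_dom B S r v.
  by apply: (diag_dom_bounded hB) => b; exact: powR_neg_le r0.
pose j v := of_H Hs r v.
have jE v : interp_inj Hs r (j v) = interp_injH Hs v by exact/of_HE/dr.
have jC v : `|j v| <= eps `^ r * `|v|.
  rewrite (interp_normE (jE v)); apply: (diag_op_norm_le hB).
    exact: powR_ge0.
  by move=> b; exact: powR_neg_le r0.
have jB u v : j (u - v) = j u - j v.
  by apply: of_H_unique; rewrite !raddfB/= !jE.
have jc : continuous j.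
  move=> u; apply/cvgrPdist_lt => e e0; near=> v.
  rewrite -jB; apply: le_lt_trans (jC _) _.
  rewrite mulrC -ltr_pdivlMr ?powR_gt0//.
  by near: v; apply: cvgr_dist_lt; rewrite ?divr_gt0// powR_gt0.
have xj v : hdot x (j v) = 0.
  have : (fun v => hdot x (j v)) = (fun=> 0) :> (H -> R).
    apply: (@continuous_eq_dense _ _ _ _ _ (@norm_hausdorff _ _) hB.2).
    - move=> u; apply: continuous_comp; [exact: jc|exact: hdot_continuous].
    - by move=> u; exact: cvg_cst.
    move=> _ [A [c [[fA AB] ->]]].
    have -> : j (\sum_(b \in A) c b *: b) =
        \sum_(b \in A) (c b * wt r b) *: interp_basis r b.
      apply: of_H_unique; rewrite !fsbig_finite// !raddf_sum/= big_seq [RHS]big_seq.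
      apply: eq_bigr => b; rewrite in_fset_set// inE => /AB Bb.
      by rewrite scalerA mulfK ?wt_neq0// !linearZ/= ibE.
    rewrite hdot_sumr// fsbig1// => b /AB Bb.
    by rewrite hdotZr hdotC hx// mulr0.
  by move=> /(congr1 (fun f => f v)).
have : hdot x = (fun=> 0) :> (interp_space Hs r -> R).
  apply: (@continuous_eq_dense _ _ _ _ _ (@norm_hausdorff _ _) (@interp_dense r)).
  - exact: hdot_continuous.
  - by move=> u; exact: cvg_cst.
  by move=> y [v _ /esym /of_H_unique <-]; exact: xj.
move=> /(congr1 (fun f => f x)); rewrite hdotE => /eqP.
by rewrite sqrf_eq0 normr_eq0 => /eqP.
Unshelve. all: by end_near. Qed.

(** The right-hand side is continuous and extends [hdot b]; density leaves no other candidate for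
    [xget]. *)
Let interp_dot_spec r b : B b ->
  interp_dot b = (fun x : interp_space Hs r => (wt r b)^-1 * hdot (interp_basis r b) x).
Proof.
move=> Bb; have cf : continuous
    (fun x : interp_space Hs r => (wt r b)^-1 * hdot (interp_basis r b) x).
  by move=> x; apply: cvgMr; exact: hdot_continuous.
have hf (x : interp_space Hs r) v : interp_inj Hs r x = interp_injH Hs v ->
    (wt r b)^-1 * hdot (interp_basis r b) x = hdot b v.
  by move=> xv; rewrite (interp_basis_hdot Bb xv) mulKf// wt_neq0.
rewrite /interp_dot; case: xgetP => [g _ /= [cg hg]|/(_ _ (conj cf hf))//].
apply: (@continuous_eq_dense _ _ _ _ _ (@norm_hausdorff _ _) (@interp_dense r)) => //.
by move=> x [v _ /esym xv]; rewrite (hg _ _ xv) -(hf _ _ xv).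
Qed.

Lemma interp_basis_dot r b (x : interp_space Hs r) : B b ->
  hdot (interp_basis r b) x = hdot b (S b) `^ r * interp_dot b x.
Proof. by move=> Bb; rewrite interp_dot_spec// mulVKf// wt_neq0. Qed.

Lemma interp_dot_continuous r b : B b ->
  continuous (interp_dot b : interp_space Hs r -> R).
Proof.
by move=> Bb; rewrite interp_dot_spec// => x; apply: cvgMr; exact: hdot_continuous.
Qed.

Lemma interp_dot_H r b (x : interp_space Hs r) v : B b ->
  interp_inj Hs r x = interp_injH Hs v -> interp_dot b x = hdot b v.
Proof.
move=> Bb xv; rewrite interp_dot_spec// (interp_basis_hdot Bb xv).
by rewrite mulKf// wt_neq0.
Qed.

Lemma interp_dotD r b (x y : interp_space Hs r) : B b ->
  interp_dot b (x + y) = interp_dot b x + interp_dot b y.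
Proof. by move=> Bb; rewrite interp_dot_spec// hdotDr mulrDr. Qed.

Lemma interp_dotB r b (x y : interp_space Hs r) : B b ->
  interp_dot b (x - y) = interp_dot b x - interp_dot b y.
Proof. by move=> Bb; rewrite interp_dot_spec// hdotBr mulrBr. Qed.

Lemma interp_dotZ r b (a : R) (x : interp_space Hs r) : B b ->
  interp_dot b (a *: x) = a * interp_dot b x.
Proof. by move=> Bb; rewrite interp_dot_spec// hdotZr mulrCA. Qed.

Lemma interp_dot_inj r (x y : interp_space Hs r) :
  (forall b, B b -> interp_dot b x = interp_dot b y) -> x = y.
Proof.
move=> h; apply: (total_inj (@interp_basis_total r)) => b Bb.
by rewrite !interp_basis_dot// h.
Qed.

Lemma interp_bessel r (x : interp_space Hs r) (A : set H) : fsets B A ->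
  \sum_(b \in A) (hdot b (S b) `^ r * interp_dot b x) ^+ 2 <= `|x| ^+ 2.
Proof.
move=> BA; have [fA AB] := BA.
apply: le_trans (bessel (@interp_basis_orthonormal r) x BA).
rewrite le_eqVlt; apply/orP; left; apply/eqP/eq_fsbigr => b bA.
by rewrite interp_basis_dot//; apply: AB; rewrite inE in bA.
Qed.

Lemma interp_norm_le r (x : interp_space Hs r) M : 0 <= M ->
  (forall A, fsets B A ->
    \sum_(b \in A) (hdot b (S b) `^ r * interp_dot b x) ^+ 2 <= M ^+ 2) ->
  `|x| <= M.
Proof.
move=> M0 hM.
apply: (parseval_le (@interp_basis_orthonormal r) (@interp_basis_total r)) => //.
move=> A BA; have [fA AB] := BA; apply: le_trans (hM A BA).
rewrite le_eqVlt; apply/orP; left; apply/eqP/eq_fsbigr => b bA.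
by rewrite interp_basis_dot//; apply: AB; rewrite inE in bA.
Qed.

Lemma interp_riesz_fischer r (c : H -> R) M :
  (forall A, fsets B A -> \sum_(b \in A) (hdot b (S b) `^ r * c b) ^+ 2 <= M) ->
  exists x : interp_space Hs r, forall b, B b -> interp_dot b x = c b.
Proof.
move=> /(riesz_fischer_coord (@interp_basis_orthonormal r))[x hx].
exists x => b Bb; apply: (mulfI (wt_neq0 r Bb)).
by rewrite -interp_basis_dot// hx.
Qed.

(** The inclusion [g] of the smaller space into the larger one is continuous, so both sides are
    continuous on the smaller space and agree on its dense part coming from [H]. *)
Lemma interp_dot_nested r r' b (x : interp_space Hs r) (y : interp_space Hs r') :
  B b -> interp_inj Hs r x = interp_inj Hs r' y -> interp_dot b x = interp_dot b y.
Proof.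
move=> Bb; wlog rr' : r r' x y / r' <= r.
  move=> h xy; have [rr'|/ltW rr'] := leP r' r; first exact: h.
  by apply/esym/h.
have [C hC] := interp_nested_continuous Hs rr'.
have ex (z : interp_space Hs r) : {z' : interp_space Hs r' |
    interp_inj Hs r z = interp_inj Hs r' z'}.
  apply: cid; have : range (interp_inj Hs r) (interp_inj Hs r z) by exists z.
  by move=> /(interp_nested rr')[z' _ <-]; exists z'.
pose g z := sval (ex z).
have gE z : interp_inj Hs r z = interp_inj Hs r' (g z) by rewrite /g; case: (ex z).
have cg : continuous g.
  move=> z; apply/cvgrPdist_lt => e e0; near=> z'.
  have : `|g z - g z'| <= C * `|z - z'| by apply: hC; rewrite !raddfB/= !gE.
  move=> /le_lt_trans; apply.
  (* The sign of [C] is unknown; [|C| + 1] is a positive constant one can divide by. *)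
  have CC : C * `|z - z'| <= (`|C| + 1) * `|z - z'|.
    by rewrite ler_wpM2r// (le_trans (ler_norm _))// lerDl.
  apply: le_lt_trans CC _; rewrite mulrC -ltr_pdivlMr ?ltr_wpDl//.
  by near: z'; apply: cvgr_dist_lt; rewrite ?divr_gt0// ltr_wpDl.
have : interp_dot b \o g = interp_dot b.
  apply: (@continuous_eq_dense _ _ _ _ _ (@norm_hausdorff _ _) (@interp_dense r)).
  - move=> z; apply: continuous_comp; first exact: cg.
    exact: interp_dot_continuous.
  - exact: interp_dot_continuous.
  move=> z [v _ /esym zv]; rewrite (interp_dot_H Bb zv)/=.
  by apply: interp_dot_H => //; rewrite -gE.
move=> /(congr1 (fun f => f x))/= <- xy; congr interp_dot.
by apply: (@interp_inj_injective _ _ _ _ Hs r'); rewrite -gE.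
Unshelve. all: by end_near. Qed.

(** Identifies an element of H_(-1) built from prescribed coordinates with a given element of
    H_delta. *)
Lemma interp_dot_nested_inj r r' (x : interp_space Hs r) (y : interp_space Hs r') :
  (forall b, B b -> interp_dot b x = interp_dot b y) ->
  interp_inj Hs r x = interp_inj Hs r' y.
Proof.
move=> h; wlog rr' : r r' x y h / r' <= r.
  move=> H0; have [rr'|/ltW rr'] := leP r' r; first exact: H0.
  by apply/esym/H0 => // b Bb; rewrite h.
have : range (interp_inj Hs r) (interp_inj Hs r x) by exists x.
move=> /(interp_nested rr')[z _ zx]; rewrite -zx; congr (interp_inj _ _ _).
by apply: interp_dot_inj => b Bb; rewrite -h//; exact: interp_dot_nested.
Qed.

(** * Action of the semigroup on coordinates of H_r *)

Section semigroup.
Variables (A : H -> H) (M t : R).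
Hypotheses (t_ge0 : 0 <= t) (AM : forall b, B b -> hdot b (A b) <= M).

Let ex := fun b => expR (t * hdot b (A b)).

Let ex_le b : B b -> `|ex b| <= expR (t * M).
Proof.
by move=> Bb; rewrite ger0_norm ?expR_ge0// ler_expR ler_wpM2l ?AM.
Qed.

Let exp_bound r (x : interp_space Hs r) C : fsets B C ->
  \sum_(b \in C) (wt r b * (ex b * interp_dot b x)) ^+ 2 <= (expR (t * M) * `|x|) ^+ 2.
Proof.
move=> BC; have [fC CB] := BC; rewrite exprMn.
apply: le_trans (ler_wpM2l (sqr_ge0 _) (interp_bessel x BC)).
rewrite !fsbig_finite// mulr_sumr big_seq [leRHS]big_seq ler_sum// => b.
rewrite in_fset_set// inE => /CB Bb.
rewrite mulrCA exprMn ler_wpM2r ?sqr_ge0//.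
by rewrite -real_normK ?num_real// ler_pXn2r ?nnegrE ?expR_ge0// ex_le.
Qed.

(** The diagonal operator [f] is built on H_r from its coordinates by Riesz-Fischer. It is bounded
    because the eigenvalues of [A] are at most [M] and t >= 0, and it restricts to [exp_op] on [H],
    so it is the map that [xget] returns. *)
Lemma interp_dot_exp r b (x : interp_space Hs r) : B b ->
  interp_dot b (interp_exp A t x) = expR (t * hdot b (A b)) * interp_dot b x.
Proof.
move=> Bb.
have exf (z : interp_space Hs r) : {z' : interp_space Hs r |
    forall b, B b -> interp_dot b z' = ex b * interp_dot b z}.
  by apply/cid/interp_riesz_fischer => C BC; exact: exp_bound.
pose f z := sval (exf z).
have fE z c : B c -> interp_dot c (f z) = ex c * interp_dot c z.
  by rewrite /f; case: (exf z) => z' /= h /h.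
have cf : continuous f.
  move=> z; apply/cvgrPdist_lt => e e0; near=> z'.
  have : `|f z - f z'| <= expR (t * M) * `|z - z'|.
    apply: interp_norm_le => [|C BC]; first by rewrite mulr_ge0// expR_ge0.
    apply: le_trans (exp_bound (z - z') BC); have [_ CB] := BC.
    rewrite le_eqVlt; apply/orP; left; apply/eqP/eq_fsbigr => c cC.
    have Bc : B c by apply: CB; rewrite inE in cC.
    by rewrite !interp_dotB// !fE// -mulrBr.
  move=> /le_lt_trans; apply; rewrite mulrC -ltr_pdivlMr ?expR_gt0//.
  by near: z'; apply: cvgr_dist_lt; rewrite ?divr_gt0// expR_gt0.
have hf z v : interp_inj Hs r z = interp_injH Hs v ->
    interp_inj Hs r (f z) = interp_injH Hs (exp_op B A t v).
  move=> zv; have dv : diag_dom B A (fun x => expR (t * x)) v.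
    by apply: (diag_dom_bounded hB) => c; exact: ex_le.
  (* For r >= 0 this is a genuine claim: the semigroup preserves the domain of the r-th power. *)
  have dr : frac_dom B S r (exp_op B A t v).
    apply/esum_ltyP; exists ((expR (t * M) * `|z|) ^+ 2) => C BC.
    apply: le_trans (exp_bound z BC); have [_ CB] := BC.
    rewrite le_eqVlt; apply/orP; left; apply/eqP/eq_fsbigr => c cC.
    have Bc : B c by apply: CB; rewrite inE in cC.
    by rewrite real_normK ?num_real// (diag_op_dot hB)// (interp_dot_H Bc zv).
  have [y yv] := interp_of_frac_dom dr.
  rewrite -yv; congr (interp_inj _ _ _); apply: interp_dot_inj => c Bc.
  by rewrite fE// (interp_dot_H Bc yv) (diag_op_dot hB)// (interp_dot_H Bc zv).
rewrite /interp_exp; case: xgetP => [g _ /= [cg hg]|/(_ _ (conj cf hf))//].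
suff -> : g = f by rewrite fE.
apply: (@continuous_eq_dense _ _ _ _ _ (@norm_hausdorff _ _) (@interp_dense r)) => //.
move=> z [v _ /esym zv]; apply: (@interp_inj_injective _ _ _ _ Hs r).
by rewrite (hg _ _ zv) (hf _ _ zv).
Unshelve. all: by end_near. Qed.

End semigroup.

End interpolation_coordinates.

(** * Bochner integrals of functions with values in a line *)

(** The integral of a nonnegative function is a supremum over the simple functions below it, so
    pointwise domination suffices. It is applied to [|f x - g n x|], whose measurability is not
    established. *)
Lemma le_integral_nonmeas d (T : measurableType d) (R : realType)
    (mu : {measure set T -> \bar R}) (D : set T) (f g : T -> \bar R) :
  (forall x, D x -> 0 <= f x)%E -> (forall x, D x -> f x <= g x)%E ->
  (\int[mu]_(x in D) f x <= \int[mu]_(x in D) g x)%E.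
Proof.
move=> f0 fg; have g0 x : D x -> (0 <= g x)%E.
  by move=> Dx; exact: le_trans (f0 _ Dx) (fg _ Dx).
rewrite !ge0_integralE//; apply: le_ereal_sup => _ [h /= hf <-].
exists h => //= x; apply: le_trans (hf x) _.
by rewrite /patch; case: ifPn => // /set_mem /fg.
Qed.

Section bochner_hilbert.
Import HBNNSimple.
Context d (T : measurableType d) (R : realType) (K : hilbertType R).
Variables (mu : {measure set T -> \bar R}) (D : set T).
Hypotheses (mD : measurable D) (muD : (mu D < +oo)%E).
Implicit Types (g : T -> K) (u : K).

Lemma integrable_bounded_indic (A : set T) (r : R) : measurable A ->
  mu.-integrable D (fun x => (r * \1_A x)%:E).
Proof.
move=> mA; under eq_fun do rewrite EFinM.
apply: integrableZl => //; apply/integrableP; split.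
  exact/measurable_EFinP/measurable_indic.
under eq_integral do rewrite gee0_abs//.
rewrite integral_indic//; apply: le_lt_trans muD.
by rewrite le_measure ?inE//; exact: measurableI.
Qed.

(** Testing against [u] turns simple integrals into scalar Lebesgue integrals of sums of indicators.
    The finite measure of [D] covers the level set of 0, on which [simple_on] imposes no
    finiteness. *)
Lemma simple_integral_dot g u : simple_on mu D g ->
  mu.-integrable D (fun x => (hdot u (g x))%:E) /\
  (hdot u (simple_integral mu D g))%:E = (\int[mu]_(x in D) (hdot u (g x))%:E)%E.
Proof.
move=> [fg mg _].
pose A y := D `&` g @^-1` [set y].
have mA y : measurable (A y) by exact: mg.
pose s := finmap.enum_fset (fset_set (g @` D)).
have E x : D x -> (hdot u (g x))%:E = (\sum_(y <- s) (hdot u y * \1_(A y) x)%:E)%E.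
  move=> Dx; rewrite -(fsbig_finite _ (fun y => (hdot u y * \1_(A y) x)%:E))//.
  rewrite (fsbigD1 (g x))//=; last by exists x.
  rewrite fsbig1 ?adde0; first by rewrite indicE mem_set ?mulr1.
  move=> y [_ /= yg]; rewrite indicE memNset ?mulr0// => -[_ /= gy].
  by apply: yg.
have int y : mu.-integrable D (fun x => (hdot u y * \1_(A y) x)%:E).
  exact: integrable_bounded_indic.
split.
  apply: (eq_integrable mD (fun x => \sum_(y <- s) (hdot u y * \1_(A y) x)%:E)%E).
    by move=> x /set_mem Dx; rewrite E.
  exact: integrable_sum.
rewrite (eq_integral (fun x => \sum_(y <- s) (hdot u y * \1_(A y) x)%:E)%E); last first.
  by move=> x /set_mem Dx; rewrite E.
rewrite integral_sum// /simple_integral hdot_sumr// fsbig_finite// -sumEFin.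
apply: eq_bigr => y _; under eq_integral do rewrite EFinM.
rewrite hdotZr integralZl//; last first.
  have := integrable_bounded_indic 1 (mA y).
  by under eq_fun do rewrite mul1r.
rewrite integral_indic// (_ : A y `&` D = A y); last by rewrite /A setIAC setIid.
rewrite mulrC EFinM fineK// ge0_fin_numE//; apply: le_lt_trans muD.
by rewrite le_measure ?inE//; move=> ? [].
Qed.

Variables (a : T -> R) (e : K).
Hypotheses (ma : measurable_fun D a) (a_ge0 : forall x, D x -> 0 <= a x).
Hypothesis a_fin : (\int[mu]_(x in D) (a x)%:E < +oo)%E.

Let int_a : mu.-integrable D (EFin \o a).
Proof.
apply/integrableP; split; first exact/measurable_EFinP.
rewrite (eq_integral (EFin \o a))// => x /set_mem Dx.
by rewrite gee0_abs// lee_fin a_ge0.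
Qed.

(** For [u] in the unit ball, Cauchy-Schwarz bounds the error of the n-th simple integral tested
    against [u] by the integral of [|f - g n|], which tends to 0. Rescaling reaches every [u]. *)
Lemma has_bochner_integral_unique f l : (forall x, D x -> f x = a x *: e) ->
  has_bochner_integral mu D f l ->
  l = fine (\int[mu]_(x in D) (a x)%:E) *: e.
Proof.
move=> fE [g [sg _ fg gl]].
suff h u : `|u| <= 1 -> hdot u l = hdot u (fine (\int[mu]_(x in D) (a x)%:E) *: e).
  apply: hdot_inj => u; set l' := _ *: e.
  have k0 : 0 < `|u| + 1 by rewrite ltr_wpDl.
  have := h ((`|u| + 1)^-1 *: u).
  rewrite !hdotZl normrZ normfV (ger0_norm (ltW k0)) ler_pdivrMl// mulr1 lerDl ler01.
  by move=> /(_ isT)/mulfI; apply; rewrite invr_neq0// gt_eqF.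
move=> u1.
have int_f : mu.-integrable D (fun x => (hdot u (f x))%:E).
  apply: (eq_integrable mD (fun x => (hdot u e)%:E * (a x)%:E)%E).
    by move=> x /set_mem Dx; rewrite fE// hdotZr -EFinM mulrC.
  exact: integrableZl.
have If : (\int[mu]_(x in D) (hdot u (f x))%:E =
    (hdot u (fine (\int[mu]_(x in D) (a x)%:E) *: e))%:E)%E.
  rewrite (eq_integral (fun x => (hdot u e)%:E * (a x)%:E)%E); last first.
    by move=> x /set_mem Dx; rewrite fE// hdotZr -EFinM mulrC.
  rewrite integralZl// hdotZr mulrC EFinM fineK// ge0_fin_numE//.
  by apply: integral_ge0 => x Dx; rewrite lee_fin a_ge0.
pose r n := hdot u (simple_integral mu D (g n)).
have rl : r n @[n --> \oo] --> hdot u l.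
  by apply: continuous_cvg gl; exact: hdot_continuous.
apply/esym; apply: (cvg_unique _ _ rl) => //.
apply/cvgrPdist_le => c c0.
have /fine_cvgP[fin cv] := fg.
move/cvgrPdist_le : cv => /(_ _ c0) cv.
near=> n.
have [ig Ig] := simple_integral_dot u (sg n).
rewrite -lee_fin -abse_EFin EFinB -If Ig -integralB//.
apply: (@le_trans _ _ (\int[mu]_(x in D) `|f x - g n x|%:E)%E).
  apply: le_trans (le_abse_integral _ _ _) _ => //.
    by case/integrableP: (integrableB mD int_f ig).
  apply: le_integral_nonmeas => // x Dx; rewrite -EFinB/= lee_fin -hdotBr.
  apply: le_trans (hdot_le _ _) _; rewrite -[leRHS]mul1r ler_wpM2r//.
have ffin : (\int[mu]_(x in D) `|f x - g n x|%:E)%E \is a fin_num by near: n.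
rewrite -[leLHS]fineK// lee_fin.
have : `|0 - fine (\int[mu]_(x in D) `|f x - g n x|%:E)| <= c by near: n.
by rewrite sub0r normrN; apply: le_trans; exact: ler_norm.
Unshelve. all: by end_near. Qed.

(** Multiplying [e] by nonnegative simple functions that increase to [a] gives the approximants;
    dominated convergence, with [a] itself as the bound, gives both limits. *)
Lemma has_bochner_integral_line f : (forall x, D x -> f x = a x *: e) ->
  has_bochner_integral mu D f (fine (\int[mu]_(x in D) (a x)%:E) *: e).
Proof.
move=> fE.
have ma' : measurable_fun D (EFin \o a) by exact/measurable_EFinP.
pose h n := nnsfun_approx mD ma' n.
have h0 n x : 0 <= h n x by exact: fun_ge0.
have ha x : D x -> h n x @[n --> \oo] --> a x.
  move=> Dx; have := @cvg_nnsfun_approx _ _ _ _ mD _ ma' _ _ Dx.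
  move=> /(_ _)/fine_cvg; apply => y Dy; rewrite lee_fin a_ge0//.
have hle n x : D x -> h n x <= a x.
  move=> Dx; rewrite -(cvg_lim _ (ha _ Dx))//.
  apply: nondecreasing_cvgn_le; last by apply/cvg_ex; exists (a x); exact: ha.
  by move=> i j ij; have /lefP := nd_nnsfun_approx mD ma' ij; exact.
have mh n : measurable_fun D (EFin \o h n).
  by apply/measurable_EFinP; apply: measurable_funTS; exact: measurable_funPT.
have sg n : simple_on mu D (fun x => h n x *: e).
  have mg y : measurable (D `&` (fun x => h n x *: e) @^-1` [set y]).
    (* The level set is the preimage under [h n] of [C], which is closed and hence Borel, also when
       [e] is 0. *)
    pose C := [set r : R | r *: e = y].
    have mC : measurable C.
      apply: closed_measurable.
      have -> : C = (fun r => r *: e) @^-1` [set y] by [].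
      apply: closed_comp => [r _|]; last first.
        exact: (accessible_closed_set1 (hausdorff_accessible (@norm_hausdorff _ _))).
      exact: scalel_continuous.
    have := measurable_funPT (h n) measurableT C mC.
    by rewrite setTI => mhC; exact: measurableI.
  split => //.
    have -> : (fun x => h n x *: e) @` D = (fun r => r *: e) @` (h n @` D).
      by rewrite [RHS]image_comp.
    apply: finite_image; apply: sub_finite_set (fimfunP (h n)) => _ [x _ <-]; by exists x.
  move=> y _; apply: le_lt_trans muD.
  by rewrite le_measure ?inE//; move=> ? [].
have hc x : D x -> (EFin \o h n) x @[n --> \oo] --> (EFin \o a) x.
  by move=> Dx; apply: (cvg_comp _ _ (ha _ Dx)); exact: cvg_refl.
have dom : {ae mu, forall x, forall n, D x -> (`|(EFin \o h n) x| <= (EFin \o a) x)%E}.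
  apply: aeW => x n Dx; rewrite gee0_abs ?lee_fin//; exact: hle.
have [_ dc1 dc2] := dominated_convergence mD mh ma' (aeW _ hc) int_a dom.
exists (fun n x => h n x *: e); split => //.
- by apply: aeW => x Dx; rewrite fE//; apply: cvgZr_tmp; exact: ha.
- rewrite (_ : (fun n => _) = fun n =>
      (`|e|%:E * \int[mu]_(x in D) `|(EFin \o h n) x - (EFin \o a) x|)%E); last first.
    apply/funext => n; rewrite -ge0_integralZl//; last first.
      apply: measurableT_comp => //; apply: emeasurable_funB => //; exact: mh.
    apply: eq_integral => x /set_mem Dx.
    by rewrite fE// -scalerBl normrZ mulrC distrC EFinM.
  rewrite -[X in _ --> X](mule0 `|e|%:E).
  by apply: cvgeZl => //; exact: dc1.
- rewrite (_ : (fun n => _) = fun n => fine (\int[mu]_(x in D) (h n x)%:E)%E *: e).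
    by apply: cvgZr_tmp; apply: fine_cvg; rewrite fineK//; exact: integrable_fin_num.
  apply/funext => n; apply: hdot_inj => u.
  have [_ Iu] := simple_integral_dot u (sg n).
  have int_h : mu.-integrable D (EFin \o h n).
    apply: le_integrable int_a => // x Dx; rewrite !gee0_abs ?lee_fin ?a_ge0//.
    exact: hle.
  apply: EFin_inj; rewrite Iu hdotZr mulrC EFinM fineK; last exact: integrable_fin_num.
  rewrite -integralZl//; apply: eq_integral => x _.
  by rewrite hdotZr mulrC EFinM.
Qed.

Lemma bochner_integral_line f : (forall x, D x -> f x = a x *: e) ->
  bochner_integral mu D f = fine (\int[mu]_(x in D) (a x)%:E) *: e.
Proof.
move=> fE; rewrite /bochner_integral; case: xgetP => [l _ /=|].
  exact: has_bochner_integral_unique.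
by move=> /(_ _ (has_bochner_integral_line fE)).
Qed.

End bochner_hilbert.

(** * Measurability and null sets *)

Lemma continuous_borel_measurable (R : realType) (V : ptopologicalType) (f : V -> R) :
  continuous f -> measurable_fun setT (f : borel_type V -> R).
Proof.
move=> /continuousP cf; apply: (measurability _ (RGenOInfty.measurableE R)).
move=> /= _ [_ [x ->]] <-; rewrite setTI; apply: sub_sigma_algebra.
by apply: cf; exact: interval_open.
Qed.

(** Distinct basis vectors are at distance at least 1, so choosing for each a point of the dense set
    at distance below 1/2 is injective. *)
Lemma separable_orthonormal_countable (R : realType) (H : hilbertType R) (B : set H) :
  separable H -> (forall b c, B b -> B c -> hdot b c = (b == c)%:R) -> countable B.
Proof.
move=> [D cD /dense_normP dD] onB.
have ex b : {y | D y & `|b - y| < 2^-1}.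
  by apply: cid2; apply: dD; rewrite invr_gt0.
pose p b := s2val (ex b).
have pD b : D (p b) by rewrite /p; case: (ex b).
have pb b : `|b - p b| < 2^-1 by rewrite /p; case: (ex b).
have inj : {in B &, injective p}.
  move=> b c /set_mem Bb /set_mem Bc pbc; apply: contrapT => /eqP bc.
  have : `|b - c| < 1.
    have -> : b - c = (b - p b) - (c - p c) by rewrite pbc opprB addrA subrK.
    apply: le_lt_trans (ler_normB _ _) _.
    by have := pb b; have := pb c; lra.
  rewrite ltNge => /negP; apply.
  rewrite -(@expr_ge1 _ 2)// -hdotE hdotBr !(hdotC (b - c)) !hdotBr.
  by rewrite !onB// !eqxx (negbTE bc) (eq_sym c) (negbTE bc) mulr1n mulr0n; lra.
have /countable_injP[h hi] := cD.
apply/countable_injP; exists (h \o p) => b c bB cB /= hbc.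
by apply: inj => //; apply: hi => //; rewrite inE.
Qed.

Lemma ae_forall_countable d (T : measurableType d) (R : realType)
    (mu : {measure set T -> \bar R}) (I : choiceType) (B : set I) (Q : I -> T -> Prop) :
  countable B -> (forall b, B b -> {ae mu, forall x, Q b x}) ->
  {ae mu, forall x, forall b, B b -> Q b x}.
Proof.
move=> /countable_injP[g gi] hQ.
have : {ae mu, forall x, forall n, forall b, B b -> g b = n -> Q b x}.
  apply: ae_foralln => n.
  have [[b [Bb gb]]|nb] := pselect (exists b, B b /\ g b = n).
    apply: filterS (hQ b Bb) => x Qx c Bc gc.
    by rewrite (gi c b) ?inE// gc gb.
  by apply: aeW => x b Bb gb; exfalso; apply: nb; exists b.
by apply: filterS => x h b Bb; exact: h _ _ Bb erefl.
Qed.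

Lemma measurable_esum d (T : measurableType d) (R : realType) (I : choiceType)
    (B : set I) (D : set T) (c : I -> T -> R) : countable B ->
  (forall b, B b -> measurable_fun D (c b)) ->
  (forall b x, 0 <= c b x) ->
  measurable_fun D (fun x => \esum_(b in B) (c b x)%:E)%E.
Proof.
move=> cB mc c0.
have [->|/set0P[b0 Bb0]] := eqVneq B set0.
  by under eq_fun do rewrite esum_set0; exact: measurable_cst.
have /countable_injP[g gi] := cB.
have ex n : exists b, forall c, B c -> g c = n -> b = c.
  have [[b [Bb gb]]|nb] := pselect (exists b, B b /\ g b = n).
    by exists b => c' Bc gc; apply: gi; rewrite ?inE//; congruence.
  by exists b0 => c' Bc gc; exfalso; apply: nb; exists c'.
(* [h] inverts [g] on the image of [B]; elsewhere its value is arbitrary. *)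
pose h n := sval (cid (ex n)).
have hg b : B b -> h (g b) = b.
  by move=> Bb; rewrite /h; case: cid => b' /= /(_ b Bb erefl).
have BE : B = [set h n | n in g @` B].
  apply/seteqP; split=> [b Bb|_ [n [b Bb <-] <-]]; last by rewrite hg.
  by exists (g b); [exists b|rewrite hg].
have hi : set_inj (g @` B) h.
  by move=> _ _ /set_mem[b Bb <-] /set_mem[b' Bb' <-]; rewrite !hg// => ->.
have E x : (\esum_(b in B) (c b x)%:E =
    \sum_(0 <= i <oo | i \in g @` B) (c (h i) x)%:E)%E.
  by rewrite [in LHS]BE esum_set_image// => n _; rewrite lee_fin.
rewrite (funext E).
apply: (ge0_emeasurable_sum (P := mem (g @` B))).
  by move=> k x Dx _; rewrite lee_fin.
move=> k /set_mem[b Bb <-]; apply/measurable_EFinP; rewrite hg//; exact: mc.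
Qed.

(** Used for the norm of [to_H] along a path: the map [to_H] comes from [xget], and only coordinates
    are known to be measurable. *)
Lemma measurable_l2_norm d (T : measurableType d) (R : realType) (I : choiceType)
    (B : set I) (D : set T) (c : I -> T -> R) (N : T -> R) : countable B ->
  (forall b, B b -> measurable_fun D (c b)) ->
  (forall x, D x -> 0 <= N x) ->
  (forall x, D x -> ((N x ^+ 2)%:E = \esum_(b in B) (c b x ^+ 2)%:E)%E) ->
  measurable_fun D N.
Proof.
move=> cB mc N0 hN.
have m2 : measurable_fun D (fun x => N x ^+ 2).
  apply/measurable_EFinP.
  apply: (eq_measurable_fun (fun x => \esum_(b in B) (c b x ^+ 2)%:E)%E).
    by move=> x /set_mem Dx /=; rewrite hN.
  apply: measurable_esum => // [b Bb|b x]; last exact: sqr_ge0.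
  by apply: measurable_funX; exact: mc.
apply: (eq_measurable_fun (Num.sqrt \o (fun x => N x ^+ 2))).
  by move=> x /set_mem Dx /=; rewrite sqrtr_sqr ger0_norm// N0.
apply: measurableT_comp => //; apply: continuous_measurable_fun.
exact: sqrt_continuous.
Qed.

(** Exchanges the quantifiers: a property that holds almost surely at each time holds, almost
    surely, at almost every time. *)
Lemma null_xsections_ysections d1 d2 (T1 : measurableType d1) (T2 : measurableType d2)
    (R : realType) (m1 : {sigma_finite_measure set T1 -> \bar R})
    (m2 : {sigma_finite_measure set T2 -> \bar R}) (A : set (T1 * T2)) :
  measurable A -> (forall x, m2 (xsection A x) = 0%E) ->
  {ae m2, forall y, m1 (ysection A y) = 0%E}.
Proof.
move=> mA A0; have := indic_fubini_tonelli m1 m2 mA.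
rewrite indic_fubini_tonelli_FE// indic_fubini_tonelli_GE//.
rewrite integral0_eq; last by move=> x _; exact: A0.
move=> /esym A0'.
have := measurable_fun_ysection m1 mA => mf.
have : (\int[m2]_(y in setT) `|(m1 \o ysection A) y| = 0)%E.
  by rewrite -[RHS]A0'; apply: eq_integral => y _; rewrite gee0_abs.
move=> /(ae_eq_integral_abs _ measurableT mf); apply: filterS => y /=.
exact.
Qed.

Lemma ae_probability1 d (T : measurableType d) (R : realType) (P : probability T R)
  (A : set T) : measurable A -> {ae P, forall x, A x} -> P A = 1%E.
Proof.
move=> mA [N [mN PN AN]].
have PA : P (~` A) = 0%E.
  by apply: (subset_measure0 (measurableC mA) mN) PN.
by rewrite -[A]setCK probability_setC ?PA ?sube0//; exact: measurableC.
Qed.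

(** * The lower bound for the convolution *)

Section exponential_integrals.
Context (R : realType).
Local Notation leb := (@lebesgue_measure R).

Lemma expR_scale_continuous (m : R) : continuous (fun s => expR (- m * s)).
Proof.
move=> s; apply: continuous_comp; last exact: continuous_expR.
exact: mulrl_continuous.
Qed.

Lemma integral_expR_decay (m t : R) : 0 < m -> 0 < t ->
  leb.-integrable `]0, t] (fun s => (expR (- m * s))%:E) /\
  (\int[leb]_(s in `]0%R, t]) (expR (- m * s))%:E = ((1 - expR (- m * t)) / m)%:E)%E.
Proof.
move=> m0 t0; split.
  apply: (@integrableS _ _ R leb `[0, t]%classic) => //.
    by apply: subset_itvr; rewrite bnd_simp.
  apply: continuous_compact_integrable; first exact: segment_compact.
  by apply: continuous_subspaceT => x; exact: expR_scale_continuous.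
rewrite integral_itv_obnd_cbnd; last first.
  apply: measurable_funTS; apply/measurable_EFinP.
  by apply: continuous_measurable_fun => x; exact: expR_scale_continuous.
pose F := fun s : R => - m^-1 * expR (- m * s).
have dF (s : R) : is_derive s 1 F (expR (- m * s)).
  have d1 : is_derive s 1 (fun s => - m * s) (- m).
    by apply: is_derive_eq; rewrite /GRing.scale/= mulr1.
  have d2 := is_derive1_comp (is_derive_expR (- m * s)) d1.
  have d3 := is_deriveZ (- m^-1) d2.
  apply: is_derive_eq d3 _.
  by rewrite /GRing.scale/= mulrCA mulrNN mulVf ?mulr1// gt_eqF.
have cF : continuous F.
  by move=> s; apply: differentiable_continuous; apply/derivable1_diffP; case: (dF s).
rewrite (@continuous_FTC2 _ _ F)//.
- by rewrite /F mulr0 expR0 -EFinB; congr EFin; field; rewrite gt_eqF.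
- by apply: continuous_subspaceT => x; exact: expR_scale_continuous.
- split.
  + by move=> s _; case: (dF s).
  + exact/cvg_at_right_filter/cF.
  + exact/cvg_at_left_filter/cF.
- by move=> s _; rewrite derive1E; exact: derive_val.
Qed.

Lemma integral_expR_sum (I : choiceType) (A : set I) (k m : I -> R) (t : R) :
  finite_set A -> 0 < t -> (forall i, A i -> 0 < m i) ->
  measurable_fun `]0, t] (fun s => \sum_(i \in A) k i * expR (- m i * s)) /\
  (\int[leb]_(s in `]0%R, t]) (\sum_(i \in A) k i * expR (- m i * s))%:E =
    (\sum_(i \in A) k i * ((1 - expR (- m i * t)) / m i))%:E)%E.
Proof.
(* Integrability is required for every index, so the rates off [A] are reset to a positive value. *)
move=> fA t0 m0; pose m' i := if i \in A then m i else 1.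
have m'0 i : 0 < m' i.
  by rewrite /m'; case: ifPn => // /set_mem; exact: m0.
have E s : \sum_(i \in A) k i * expR (- m i * s) =
    \sum_(i <- finmap.enum_fset (fset_set A)) k i * expR (- m' i * s).
  by rewrite -fsbig_finite//; apply: eq_fsbigr => i iA; rewrite /m' iA.
split.
  rewrite (funext E).
  apply: measurable_sum => i; apply: measurable_funM => //.
  apply: measurable_funTS; apply: continuous_measurable_fun => x.
  exact: expR_scale_continuous.
under eq_integral do rewrite E -sumEFin.
rewrite integral_sum//; last first.
  move=> i; have [int _] := integral_expR_decay (m'0 i) t0.
  have h : leb.-integrable `]0, t] (fun s => (k i)%:E * (expR (- m' i * s))%:E)%E.
    exact: integrableZl.
  by apply: eq_integrable h => // s _; rewrite EFinM.
rewrite fsbig_finite// -sumEFin big_seq [RHS]big_seq; apply: eq_bigr => i.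
rewrite in_fset_set// => iA.
under eq_integral do rewrite EFinM.
have [int e] := integral_expR_decay (m'0 i) t0.
by rewrite integralZl// e /m' iA.
Qed.

End exponential_integrals.

Section lower_bound.
Context (R : realType) (H : hilbertType R) (B A : set H).
Local Notation leb := (@lebesgue_measure R).
Hypotheses (onB : forall b c, B b -> B c -> hdot b c = (b == c)%:R) (BA : fsets B A).
Variables (lambda c : H -> R) (eta l0 m t : R) (V : R -> H).
Hypotheses (t_gt0 : 0 < t) (m_ge0 : 0 <= m) (l0_gt0 : 0 < l0 + eta).
Hypothesis mu_gt0 : forall b, A b -> 0 < eta + lambda b.
Hypothesis m_le : forall b, A b -> m <= eta + lambda b.
Hypothesis mV : measurable_fun `]0, t] (fun s => `|V s|).
Hypothesis hV : {ae leb, forall s, `]0, t]%classic s ->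
  forall b, A b -> hdot b (V s) = expR (- lambda b * s) * c b}.
Hypothesis fin : (\int[leb]_(s in `]0%R, t]) (expR (- l0 * (t - s)) * `|V s|)%:E < +oo)%E.

(* With [q] the vector of coordinates [c b * (1 - exp (- mu b t)) / mu b], the
   integral of [exp (- eta s) <q, V s>] over [0, t] equals [|q|^2], while
   Cauchy-Schwarz bounds it by [|q|] times the integral on the right. *)
Lemma convolution_lower_bound :
  ((expR (- (l0 + `|eta|) * t) * (1 - expR (- m * t)) *
    Num.sqrt (\sum_(b \in A) (c b / (eta + lambda b)) ^+ 2))%:E <=
  \int[leb]_(s in `]0%R, t]) (expR (- l0 * (t - s)) * `|V s|)%:E)%E.
Proof.
have [fA AB] := BA.
pose mu b := eta + lambda b.
pose v b := c b * ((1 - expR (- mu b * t)) / mu b).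
pose q := \sum_(b \in A) v b *: b.
have q2 : `|q| ^+ 2 = \sum_(b \in A) v b ^+ 2.
  exact: (orthonormal_norm_sum (e := id) onB v BA).
pose h s := \sum_(b \in A) (v b * c b) * expR (- mu b * s).
have [mh Ih] := integral_expR_sum (fun b => v b * c b) fA t_gt0 mu_gt0.
have {}Ih : (\int[leb]_(s in `]0%R, t]) (h s)%:E = (`|q| ^+ 2)%:E)%E.
  rewrite Ih q2; congr EFin; apply: eq_fsbigr => b _.
  by rewrite expr2 -mulrA.
have := fin; set J := (\int[leb]_(s in _) _)%E => finJ.
have J0 : (0 <= J)%E.
  by apply: integral_ge0 => s _; rewrite lee_fin mulr_ge0// expR_ge0.
have mg : measurable_fun `]0, t] (fun s => expR (- l0 * (t - s)) * `|V s|).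
  apply: measurable_funM => //; apply: measurable_funTS.
  apply: continuous_measurable_fun => s.
  apply: continuous_comp; last exact: continuous_expR.
  apply: cvgMl_tmp; apply: cvgB; [exact: cvg_cst|exact: cvg_id].
set k := expR ((l0 + `|eta|) * t).
have qJ : ((`|q| ^+ 2)%:E <= (`|q| * k)%:E * J)%E.
  rewrite -Ih -ge0_integralZl//; last 2 first.
  - exact/measurable_EFinP.
  - by rewrite lee_fin mulr_ge0// expR_ge0.
  apply: (@le_trans _ _ (\int[leb]_(s in `]0%R, t]) `|h s|%:E)%E).
    apply: le_trans (lee_abs _) _.
    by apply: le_abse_integral => //; exact/measurable_EFinP.
  apply: ae_ge0_le_integral => //.
  - by apply/measurable_EFinP; apply: measurableT_comp.
  - by move=> s _; rewrite -EFinM lee_fin !mulr_ge0// expR_ge0.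
  - apply: measurable_funeM; exact/measurable_EFinP.
  apply: (@filterS _ _ (ae_filter_ringOfSetsType leb) _ _ _ hV) => s hs sD; rewrite -EFinM lee_fin.
  have -> : h s = expR (- eta * s) * hdot q (V s).
    rewrite hdotC hdot_sumr// /h !fsbig_finite// mulr_sumr big_seq [RHS]big_seq.
    apply: eq_bigr => b; rewrite in_fset_set// inE => bA.
    rewrite hdotZr hdotC hs// mulrCA [X in _ = _ * X]mulrA -expRD -mulrA.
    by rewrite [c b * _]mulrC; congr (_ * (expR _ * _)); rewrite /mu; ring.
  rewrite normrM ger0_norm ?expR_ge0//.
  apply: (@le_trans _ _ (expR (- eta * s) * (`|q| * `|V s|))).
    by rewrite ler_wpM2l ?expR_ge0// hdot_le.
  rewrite mulrCA -!mulrA ler_wpM2l// mulrA -expRD ler_wpM2r// ler_expR.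
  move: sD; rewrite /= in_itv/= => /andP[s0 st].
  (* After cancellation, the comparison of exponents reads [0 <= |eta| * t + (l0 + eta) * s]. *)
  have e1 : - eta * t <= `|eta| * t.
    by rewrite ler_pM2r// (le_trans (ler_norm _))// normrN.
  have : 0 <= `|eta| * t by rewrite mulr_ge0// ltW.
  have : 0 <= (l0 + eta) * s by rewrite mulr_ge0// ltW.
  lra.
move: finJ J0 qJ; case: J => // j _; rewrite lee_fin => j0.
rewrite -EFinM !lee_fin => qJ.
have {}qJ : `|q| <= k * j.
  apply: norm_le_of_sqr; first by rewrite mulr_ge0// expR_ge0.
  by rewrite (_ : k * j * `|q| = `|q| * k * j)//; ring.
have -> : expR (- (l0 + `|eta|) * t) = k^-1 by rewrite -expRN mulNr.
rewrite -mulrA ler_pdivrMl ?expR_gt0//; apply: le_trans qJ.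
have em : 0 <= 1 - expR (- m * t).
  by rewrite subr_ge0 -expR0 ler_expR mulNr oppr_le0 mulr_ge0// ltW.
rewrite -(@ler_pXn2r _ 2)// ?nnegrE ?mulr_ge0 ?sqrtr_ge0//.
rewrite exprMn sqr_sqrtr; last by rewrite fsumr_ge0// => b _; exact: sqr_ge0.
rewrite q2 !fsbig_finite// mulr_sumr big_seq [leRHS]big_seq ler_sum// => b.
rewrite in_fset_set// inE => bA.
(* Since [m <= mu b], the first factor is at least [1 - expR (- m * t)], uniformly in [b]; what
   remains is the coordinate weighted as in H_(-1). *)
have -> : v b = (1 - expR (- mu b * t)) * (c b / mu b) by rewrite /v; ring.
rewrite [leRHS]exprMn ler_wpM2r ?sqr_ge0// ler_pXn2r ?nnegrE//.
  by rewrite lerD2l lerN2 ler_expR !mulNr lerN2 ler_pM2r// m_le.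
by rewrite subr_ge0 -expR0 ler_expR mulNr oppr_le0 mulr_ge0// ltW// mu_gt0.
Qed.

End lower_bound.

(** * Mild solutions *)

Lemma lty_pmull (R : realType) (k : R) (x : \bar R) :
  0 < k -> (0 <= x -> k%:E * x < +oo -> x < +oo)%E.
Proof. by move=> k0; case: x => [r _ _|_|//]; rewrite ?ltry// mulry gtr0_sg// mul1e ltxx. Qed.

Lemma norm_alongE (R : realType) (V : normedModType R) (E : lmodType R)
    (f : V -> E) (x : V) : injective f -> norm_along f (f x) = `|x|%:E.
Proof.
move=> fi; rewrite /norm_along (_ : [set _ | _ in _] = [set `|x|%:E]) ?ereal_inf1//.
by apply/seteqP; split=> [_ [v /fi -> <-]//|_ ->]; exists x.
Qed.

(** [A] is prescribed only on [DA], which contains [B]. The semigroup and the powers of [S] depend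
    on [A] only through these numbers. *)
Lemma generator_eigenvalue (R : realType) (H : hilbertType R) (B : set H)
    (lambda : H -> R) (DA : set H) (A : H -> H) :
  orthonormal_basis B ->
  DA = [set v | (\esum_(b in B) (`|lambda b * hdot b v| ^+ 2)%:E < +oo)%E] ->
  (forall v, DA v -> A v = - usum B (fun b => (lambda b * hdot b v) *: b)) ->
  forall b, B b -> hdot b (A b) = - lambda b.
Proof.
move=> hB -> hA b Bb; have onB := hB.1; have totB := orthonormal_basis_total hB.
have bound A0 : fsets B A0 ->
    \sum_(c \in A0) (lambda c * hdot c b) ^+ 2 <= `|lambda b *: b| ^+ 2.
  move=> BA; apply: le_trans (bessel (e := id) onB _ BA); have [fA AB] := BA.
  rewrite le_eqVlt; apply/orP; left; apply/eqP/eq_fsbigr => c cA.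
  have Bc : B c by apply: AB; rewrite inE in cA.
  by rewrite hdotZr onB//; case: eqVneq => [->|_]; rewrite ?mulr0.
rewrite hA; last first.
  apply/esum_ltyP; exists (`|lambda b *: b| ^+ 2) => A0 BA.
  apply: le_trans (bound _ BA).
  by rewrite le_eqVlt; apply/orP; left; apply/eqP/eq_fsbigr => c _; rewrite real_normK ?num_real.
rewrite -scaleN1r hdotZr (usum_dot (e := id) onB totB bound)//= onB// eqxx.
by rewrite mulr1 mulN1r.
Qed.

(** * Estimates along a single path [Y], with the random parameter fixed *)

Section mild_solution.
Context (R : realType) (H : hilbertType R) (B : set H).
Hypothesis hB : orthonormal_basis B.
Hypothesis cB : countable B.
Variables (T eta delta eps : R) (lambda : H -> R) (A : H -> H).
Hypothesis eps_gt0 : 0 < eps.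
Hypothesis eps_le : forall b, B b -> eps <= eta + lambda b.
Hypothesis hAb : forall b, B b -> hdot b (A b) = - lambda b.
Let S v := eta *: v - A v.
Context (Hs : interpolation_family B S).
Variables (w b0 : H) (F : H -> H).
Hypotheses (hb0 : B b0) (hw0 : 0 < hdot b0 w) (hw : w = hdot b0 w *: b0).
Hypothesis hF : forall v, F v = `|v| *: w.
Local Notation leb := (@lebesgue_measure R).
Implicit Types (b : H) (t s : R).

Let onB : forall b c, B b -> B c -> hdot b c = (b == c)%:R.
Proof. by case: hB. Qed.

Let hSb b : B b -> hdot b (S b) = eta + lambda b.
Proof.
by move=> Bb; rewrite hdotBr hdotZr onB// eqxx hAb// mulr1 opprK.
Qed.

Let eps_le' b : B b -> eps <= hdot b (S b).
Proof. by move=> Bb; rewrite hSb// eps_le. Qed.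

Let e0 := of_H Hs delta b0.

Let e0E : interp_inj Hs delta e0 = interp_injH Hs b0.
Proof. by apply: of_HE; exact: diag_dom_basis. Qed.

Let ofHZ (k : R) : of_H Hs delta (k *: b0) = k *: e0.
Proof.
by apply: (of_H_unique hB eps_gt0 eps_le'); rewrite !linearZ/= e0E.
Qed.

Let expF s (v : H) :
  exp_op B A s (F v) = (hdot b0 w * (expR (- lambda b0 * s) * `|v|)) *: b0.
Proof.
rewrite hF [X in _ *: X]hw scalerA /exp_op (diag_opZ hB); last first.
  exact: diag_dom_basis.
rewrite (diag_op_basis hB)// scalerA hAb// [s * _]mulrC; congr (_ *: _); ring.
Qed.

Variables (Y : R -> interp_space Hs delta).
Hypothesis mY : forall b, B b -> measurable_fun `[0, T] (fun s => interp_dot b (Y s)).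
Hypothesis hY : forall t, 0 < t <= T -> range (interp_injH Hs) (interp_inj Hs delta (Y t)).

Let N s := `|to_H (Y s)|.

Let hYE s : 0 < s <= T -> interp_inj Hs delta (Y s) = interp_injH Hs (to_H (Y s)).
Proof. by move=> /hY[v _ vY]; rewrite (to_HE (esym vY)). Qed.

Lemma measurable_norm_solution t : 0 < t <= T -> measurable_fun `]0, t] N.
Proof.
move=> /andP[t0 tT].
have sT s : `]0, t]%classic s -> 0 < s <= T.
  by rewrite /= in_itv/= => /andP[-> st]; rewrite (le_trans st).
apply: (@measurable_l2_norm _ _ _ _ B _ (fun b s => interp_dot b (Y s))) => //.
- move=> b Bb; apply: measurable_funS (mY Bb) => //.
  by move=> s /sT/andP[s0 sT']; rewrite /= in_itv/= ltW.
- by move=> s _; rewrite normr_ge0.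
- move=> s /sT/hYE YE; rewrite /N (parseval (e := id) onB (orthonormal_basis_total hB)).
  apply: eq_esum => b Bb.
  by rewrite (interp_dot_H hB eps_gt0 eps_le' Bb YE).
Qed.

Let kern t s := expR (- lambda b0 * (t - s)) * N s.

Let kern_ge0 t s : 0 <= kern t s.
Proof. by apply: mulr_ge0; [exact: expR_ge0|exact: normr_ge0]. Qed.

Lemma measurable_kern t : 0 < t <= T -> measurable_fun `]0, t] (kern t).
Proof.
move=> tT; apply: measurable_funM; last exact: measurable_norm_solution.
apply: measurable_funTS; apply: continuous_measurable_fun => s.
apply: continuous_comp; last exact: continuous_expR.
apply: cvgMl_tmp; apply: cvgB; [exact: cvg_cst|exact: cvg_id].
Qed.

(** The integrand is the nonnegative scalar [a s] times the fixed vector [e0], so its norm integral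
    and its Bochner integral both reduce to the scalar integral of [kern]. *)
Lemma convolution_integral t : 0 < t <= T ->
  (\int[leb]_(s in `]0%R, t]) norm_along (interp_inj Hs delta)
     (interp_injH Hs (exp_op B A (t - s)%R (F (to_H (Y s))))) < +oo)%E ->
  (\int[leb]_(s in `]0%R, t]) (kern t s)%:E < +oo)%E /\
  bochner_integral leb `]0, t]
    (fun s => of_H Hs delta (exp_op B A (t - s)%R (F (to_H (Y s))))) =
  (hdot b0 w * fine (\int[leb]_(s in `]0%R, t]) (kern t s)%:E)%E) *: e0.
Proof.
move=> tT; have mk := measurable_kern tT.
have mt : measurable (`]0, t]%classic : set R) by [].
(* Finiteness of the norm integral passes to the scalar one by dividing by this norm. *)
have e0_gt0 : 0 < `|e0|.
  rewrite normr_gt0; apply/eqP => e00.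
  have /(interp_injH_injective (i := Hs)) : interp_injH Hs b0 = interp_injH Hs 0.
    by rewrite -e0E e00 !raddf0.
  move=> b00; have := onB hb0 hb0; rewrite {2}b00 hdot0r eqxx => /esym/eqP.
  by rewrite oner_eq0.
pose a s := hdot b0 w * kern t s.
have a0 s : 0 <= a s by rewrite mulr_ge0// ltW.
have ma : measurable_fun `]0, t] a by exact: measurable_funM.
have Ia : (\int[leb]_(s in `]0%R, t]) (a s)%:E =
    (hdot b0 w)%:E * \int[leb]_(s in `]0%R, t]) (kern t s)%:E)%E.
  rewrite -ge0_integralZl//.
  - exact/measurable_EFinP.
  - by move=> s _; rewrite lee_fin.
  - by rewrite lee_fin ltW.
move=> fin; have fin_a : (\int[leb]_(s in `]0%R, t]) (a s)%:E < +oo)%E.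
  apply: (@lty_pmull _ `|e0|) => //.
  - by apply: integral_ge0 => s _; rewrite lee_fin.
  - suff <- : (\int[leb]_(s in `]0%R, t]) norm_along (interp_inj Hs delta)
        (interp_injH Hs (exp_op B A (t - s)%R (F (to_H (Y s))))) =
        `|e0|%:E * \int[leb]_(s in `]0%R, t]) (a s)%:E)%E by [].
    rewrite -ge0_integralZl//.
    - apply: eq_integral => s _; rewrite expF linearZ/= -e0E -linearZ/=.
      rewrite norm_alongE; last exact: interp_inj_injective.
      by rewrite normrZ ger0_norm ?a0// mulrC EFinM.
    - exact/measurable_EFinP.
    - by move=> s _; rewrite lee_fin.
have muD : (leb `]0%R, t] < +oo)%E.
  by rewrite lebesgue_measure_itv/=; case: ifP; rewrite -?EFinB ltry.
have fin_k : (\int[leb]_(s in `]0%R, t]) (kern t s)%:E < +oo)%E.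
  apply: (@lty_pmull _ (hdot b0 w)) => //; last by rewrite -Ia.
  by apply: integral_ge0 => s _; rewrite lee_fin.
split=> //.
rewrite (@bochner_integral_line _ _ R _ leb _ _ _ a e0)//; last first.
  by move=> s _; rewrite expF ofHZ.
rewrite Ia; congr (_ *: _); rewrite fineM// ge0_fin_numE//.
by apply: integral_ge0 => s _; rewrite lee_fin.
Qed.

(** The bound on finite sums of squares is uniform, so Riesz-Fischer in H_(-1) yields a [z] with the
    coordinates of [x] off [b0]; restoring the component along [b0] shows that [x] itself lies in
    H_(-1). *)
Lemma mild_lower_bound t m (x : interp_space Hs delta) :
  0 < t <= T -> 0 < m -> (forall b, B b -> m <= eta + lambda b) ->
  {ae leb, forall s, `]0, t]%classic s -> forall b, B b -> b != b0 ->
    interp_dot b (Y s) = expR (- lambda b * s) * interp_dot b x} ->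
  (\int[leb]_(s in `]0%R, t]) (kern t s)%:E < +oo)%E ->
  exists z : interp_space Hs (-1),
    [/\ range (interp_inj Hs (-1)) (interp_inj Hs delta x),
       interp_inj Hs (-1) z =
         interp_inj Hs delta x - interp_dot b0 x *: interp_injH Hs b0 &
       expR (- (lambda b0 + `|eta|) * t) * (1 - expR (- m * t)) * `|z| <=
       fine (\int[leb]_(s in `]0%R, t]) (kern t s)%:E)%E].
Proof.
move=> tT m0 hm hae fin; have /andP[t0 _] := tT.
set J := fine _; set k := _ * _.
have k0 : 0 < k.
  by rewrite mulr_gt0 ?expR_gt0// subr_gt0 expR_lt1 mulNr oppr_lt0 mulr_gt0.
have IJ : (\int[leb]_(s in `]0%R, t]) (kern t s)%:E)%E = J%:E.
  rewrite fineK// ge0_fin_numE//.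
  by apply: integral_ge0 => s _; rewrite lee_fin.
have J0 : 0 <= J by apply: fine_ge0; apply: integral_ge0 => s _; rewrite lee_fin.
(* [b0] is excluded because the convolution alters the path in that coordinate. *)
have low C : fsets B C -> ~ C b0 ->
    \sum_(b \in C) (interp_dot b x / (eta + lambda b)) ^+ 2 <= (k^-1 * J) ^+ 2.
  move=> BC Cb0; have [fC CB] := BC.
  have : k * Num.sqrt (\sum_(b \in C) (interp_dot b x / (eta + lambda b)) ^+ 2) <= J.
    rewrite -lee_fin -IJ /k; apply: (convolution_lower_bound onB BC) => //.
    - exact: ltW.
    - by rewrite addrC; apply: lt_le_trans (eps_le hb0).
    - by move=> b /CB /eps_le; exact: lt_le_trans.
    - by move=> b /CB; exact: hm.
    - exact: measurable_norm_solution.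
    apply: (@filterS _ _ (ae_filter_ringOfSetsType leb) _ _ _ hae) => s hs sD b Cb.
    have Bb := CB _ Cb.
    have bb0 : b != b0 by apply: contra_notN Cb0 => /eqP <-.
    rewrite -hs//; apply/esym; apply: (interp_dot_H hB eps_gt0 eps_le' Bb).
    apply: hYE; move: sD; rewrite /= in_itv/= => /andP[-> st].
    by rewrite (le_trans st)//; case/andP: tT.
  rewrite mulrC -ler_pdivlMr// mulrC => h.
  rewrite -[leLHS]sqr_sqrtr; last by rewrite fsumr_ge0// => b _; exact: sqr_ge0.
  by rewrite ler_pXn2r// ?nnegrE ?sqrtr_ge0// mulr_ge0// invr_ge0 ltW.
have pow1 b : B b -> hdot b (S b) `^ (-1) = (eta + lambda b)^-1.
  move=> Bb; rewrite hSb// powR_inv1// ltW//.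
  by apply: lt_le_trans (eps_le Bb).
pose c b := if b == b0 then 0 else interp_dot b x.
have lowc C : fsets B C ->
    \sum_(b \in C) (hdot b (S b) `^ (-1) * c b) ^+ 2 <= (k^-1 * J) ^+ 2.
  move=> [fC CB].
  have BD : fsets B (C `\ b0).
    by split; [exact: finite_setD|move=> i [/CB]].
  have Db0 : ~ (C `\ b0) b0 by move=> [_]; apply.
  apply: le_trans (low _ BD Db0); rewrite le_eqVlt; apply/orP; left; apply/eqP.
  rewrite (fsbigID [set b0])//= [X in X + _]fsbig1 ?add0r.
    apply: eq_fsbigr => b /set_mem[/CB Bb /= bb0].
    by rewrite pow1// /c (introF eqP bb0) mulrC.
  by move=> b [_ ->]; rewrite /c eqxx mulr0 expr0n.
have [z hz] := interp_riesz_fischer hB eps_gt0 eps_le' Hs lowc.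
have e1E : interp_inj Hs (-1) (of_H Hs (-1) b0) = interp_injH Hs b0.
  by apply: of_HE; exact: diag_dom_basis.
(* [y] has all the coordinates of [x], hence is the same element of the ambient space. *)
pose y := z + interp_dot b0 x *: of_H Hs (-1) b0.
have yx : interp_inj Hs (-1) y = interp_inj Hs delta x.
  apply: (interp_dot_nested_inj hB eps_gt0 eps_le') => b Bb.
  rewrite /y (interp_dotD hB eps_gt0 eps_le')// (interp_dotZ hB eps_gt0 eps_le')//.
  rewrite hz// (interp_dot_H hB eps_gt0 eps_le' Bb e1E) onB// /c.
  by case: eqVneq => [->|_]; rewrite ?mulr1 ?add0r// mulr0 addr0.
exists z; split.
- by exists y.
- by rewrite -yx /y raddfD/= linearZ/= e1E addrK.
rewrite -ler_pdivlMl//; apply: (interp_norm_le hB eps_gt0 eps_le').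
  by rewrite mulr_ge0// invr_ge0 ltW.
move=> C BC; have [_ CB] := BC; apply: le_trans (lowc _ BC).
rewrite le_eqVlt; apply/orP; left; apply/eqP/eq_fsbigr => b /set_mem /CB Bb.
by rewrite hz.
Qed.

End mild_solution.

Theorem proposition3p5 (R : realType) (H : hilbertType R)
  (hHsep : separable H) (hHnt : exists u v : H, u <> v)
  (B : set H) (hB : orthonormal_basis B)
  (d : measure_display) (Omega : measurableType d) (P : probability Omega R)
  (T : R) (hT : 0 < T) (eta delta : R)
  (lambda : H -> R)
  (hlambda : (ereal_sup [set (- lambda b)%:E | b in B] < eta%:E)%E)
  (DA : set H) (A : H -> H)
  (hDA : DA = [set v | (\esum_(b in B) (`|lambda b * hdot b v| ^+ 2)%:E < +oo)%E])
  (hA : forall v, DA v -> A v = - usum B (fun b => (lambda b * hdot b v) *: b))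
  (Hs : interpolation_family B (fun v => eta *: v - A v))
  (w b0 : H) (hb0 : B b0)
  (xi : Omega -> interp_space Hs delta)
  (hxi : measurable_fun setT (xi : Omega -> borel_type (interp_space Hs delta)))
  (F : H -> H) (hFcont : continuous F)
  (hw0 : 0 < hdot b0 w) (hw : w = hdot b0 w *: b0)
  (hF : forall v, F v = `|v| *: w)
  (X : R * Omega -> interp_space Hs delta)
  (hX : measurable_fun (`[0, T] `*` setT)
          (X : R * Omega -> borel_type (interp_space Hs delta)))
  (hXH : forall (t : R) (omega : Omega), 0 < t <= T ->
     range (interp_injH Hs) (interp_inj Hs delta (X (t, omega))))
  (hXint : forall t : R, 0 < t <= T -> {ae P, forall omega : Omega,
     (\int[lebesgue_measure]_(s in `]0%R, t%R])
        norm_along (interp_inj Hs delta)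
          (interp_injH Hs (exp_op B A (t - s)%R (F (to_H (X (s, omega)))))) < +oo)%E})
  (hXmild : forall t : R, 0 < t <= T -> {ae P, forall omega : Omega,
     X (t, omega) = interp_exp A t (xi omega) +
       bochner_integral lebesgue_measure `]0, t]
         (fun s : R => of_H Hs delta (exp_op B A (t - s)%R (F (to_H (X (s, omega))))))}) :
  forall t : R, 0 < t <= T ->
    P [set omega | range (interp_inj Hs (-1)) (interp_inj Hs delta (xi omega))] = 1%E /\
    {ae P, forall omega : Omega,
      let c := hdot b0 w * expR (- (lambda b0 + `|eta|) * t) *
               (1 - expR (- (inf [set lambda b | b in B] + eta) * t)) in
      let zeta := interp_inj Hs delta (xi omega) -
                  interp_dot b0 (xi omega) *: interp_injH Hs b0 in
      let Y := X (t, omega) - interp_exp A t (xi omega) in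
      [/\ (c%:E * norm_along (interp_inj Hs (-1)) zeta
             <= (interp_dot b0 Y)%:E)%E,
          ((interp_dot b0 Y)%:E
             <= norm_along (interp_injH Hs) (interp_inj Hs delta Y))%E &
          (norm_along (interp_injH Hs) (interp_inj Hs delta Y) < +oo)%E]}.
Proof.
have [onB _] := hB.
have cB : countable B by exact: separable_orthonormal_countable hHsep onB.
have hAb := generator_eigenvalue hB hDA hA.
have [eps eps0 heps] : exists2 eps : R, 0 < eps & forall b, B b -> eps <= eta + lambda b.
  have ub b : B b -> ((- lambda b)%:E <= ereal_sup [set (- lambda b)%:E | b in B])%E.
    by move=> Bb; apply: ereal_sup_ubound; exists b.
  (* The supremum is finite: [hlambda] excludes +oo and the presence of [b0] excludes -oo. The gap
     is its distance to [eta]. *)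
  have := ub _ hb0; move: hlambda ub; case: (ereal_sup _) => [r| |]//.
  rewrite lte_fin => re ub _; exists (eta - r); first by rewrite subr_gt0.
  by move=> b /ub; rewrite lee_fin; lra.
set S := fun v => eta *: v - A v in Hs xi hxi X hX hXH hXint hXmild *.
have hSb b : B b -> hdot b (S b) = eta + lambda b.
  by move=> Bb; rewrite hdotBr hdotZr onB// eqxx hAb// mulr1 opprK.
have epsS b : B b -> eps <= hdot b (S b) by move=> Bb; rewrite hSb// heps.
have AM b : B b -> hdot b (A b) <= eta - eps.
  by move=> Bb; rewrite hAb//; have := heps _ Bb; lra.
have mdot b : B b -> measurable_fun setT (interp_dot b : borel_type (interp_space Hs delta) -> R).
  move=> Bb; apply: continuous_borel_measurable.
  by move=> x; exact: (interp_dot_continuous hB eps0 epsS Bb).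
have mxi b : B b -> measurable_fun setT (fun omega => interp_dot b (xi omega)).
  by move=> Bb; apply: measurableT_comp hxi; exact: mdot.
have mXdot b : B b -> measurable_fun (`[0, T] `*` setT) (fun p => interp_dot b (X p)).
  by move=> Bb; apply: measurableT_comp hX; exact: mdot.
have mX omega b : B b -> measurable_fun `[0, T] (fun s => interp_dot b (X (s, omega))).
  move=> Bb.
  apply: (measurable_comp _ _ (mXdot b Bb) (measurable_funTS (pair2_measurable omega))) => //.
    by apply: measurableX.
  by move=> _ [s sT <-]; split.
have conv s : 0 < s <= T -> {ae P, forall omega : Omega,
    ((\int[lebesgue_measure]_(r in `]0%R, s])
       (expR (- lambda b0 * (s - r)) * `|to_H (X (r, omega))|)%:E < +oo)%E) /\
    X (s, omega) = interp_exp A s (xi omega) +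
      (hdot b0 w * fine (\int[lebesgue_measure]_(r in `]0%R, s])
       (expR (- lambda b0 * (s - r)) * `|to_H (X (r, omega))|)%:E)%E) *: of_H Hs delta b0}.
  move=> sT; apply: filterS2 (hXint s sT) (hXmild s sT) => omega fin ->.
  have [fk ->] := convolution_integral hB cB eps0 heps hAb hb0 hw0 hw hF (mX omega)
    (fun t tT => hXH t omega tT) sT fin.
  by split.
have e0E : interp_inj Hs delta (of_H Hs delta b0) = interp_injH Hs b0.
  by apply: of_HE; exact: diag_dom_basis.
have coord s b : 0 < s <= T -> B b -> b != b0 -> {ae P, forall omega : Omega,
    interp_dot b (X (s, omega)) = expR (- lambda b * s) * interp_dot b (xi omega)}.
  move=> sT Bb bb0; apply: filterS (conv s sT) => omega [_ ->].
  rewrite (interp_dotD hB eps0 epsS)// (interp_dotZ hB eps0 epsS)//.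
  rewrite (interp_dot_H hB eps0 epsS Bb e0E) (onB b b0)// (negbTE bb0) mulr0 addr0.
  rewrite (interp_dot_exp hB eps0 epsS _ AM)//; last by case/andP: sT => /ltW.
  by rewrite hAb// [s * _]mulrC.
have ae_coord : {ae P, forall omega, forall b, B b -> b != b0 ->
    {ae lebesgue_measure, forall s, `]0, T]%classic s ->
      interp_dot b (X (s, omega)) = expR (- lambda b * s) * interp_dot b (xi omega)}}.
  apply: ae_forall_countable => // b Bb.
  have [->|bb0] := eqVneq b b0; first by apply: aeW.
  pose g (p : R * Omega) :=
    interp_dot b (X p) - expR (- lambda b * p.1) * interp_dot b (xi p.2).
  (* The pairs at which coordinate [b] fails to evolve freely. Time 0 is left out since the mild
     equation says nothing there. *)
  pose E := (`]0, T]%classic `*` setT) `&` g @^-1` (~` [set 0]).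
  have mg : measurable_fun (`]0, T]%classic `*` [set: Omega]) g.
    apply: measurable_funB.
      apply: measurable_funS (mXdot b Bb) => //; first exact: measurableX.
      by move=> [s o] [/= + _]; rewrite !in_itv/= => /andP[/ltW -> ->].
    apply: measurable_funTS; apply: measurable_funM.
      apply: (measurableT_comp (f := fun s => expR (- lambda b * s)) _ measurable_fst).
      by apply: continuous_measurable_fun => x; exact: expR_scale_continuous.
    exact: (measurableT_comp (mxi b Bb) measurable_snd).
  have mE : measurable E.
    by apply: mg; [exact: measurableX|exact: measurableC].
  have PE s : P (xsection E s) = 0%E.
    have mEs : measurable (xsection E s) by exact: measurable_xsection.
    have [sT|sT] := boolP (0 < s <= T).
      apply: measure_negligible => //; apply: negligibleS (coord s b sT Bb bb0).
      move=> omega; rewrite /xsection/= inE => -[_ /= h e]; apply: h.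
      by rewrite /g/= e subrr.
    rewrite (_ : xsection E s = set0) ?measure0// -subset0 => omega.
    by rewrite /xsection/= inE => -[[/= + _] _]; rewrite in_itv/= (negbTE sT).
  have := @null_xsections_ysections _ _ _ _ R lebesgue_measure P _ mE PE.
  apply: filterS => omega h _; exists (ysection E omega); split => //.
    exact: measurable_ysection.
  move=> s /= ns; rewrite /ysection/= inE; split.
    by split=> //; apply: contrapT => sD; apply: ns => /sD.
  by move=> /= /eqP; rewrite subr_eq0 => /eqP gs; apply: ns.
move=> t tT; have /andP[t0 tT'] := tT.
pose m := inf [set lambda b | b in B] + eta.
have lbB : lbound [set lambda b | b in B] (eps - eta).
  by move=> _ [b Bb <-]; have := heps _ Bb; lra.
have m0 : 0 < m.
  have : eps - eta <= inf [set lambda b | b in B].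
    by apply: lb_le_inf => //; exists (lambda b0), b0.
  by rewrite /m; move: eps0; lra.
have hm b : B b -> m <= eta + lambda b.
  move=> Bb; rewrite /m addrC lerD2l; apply: ge_inf; last by exists b.
  by exists (eps - eta).
have good : {ae P, forall omega, exists (z : interp_space Hs (-1)) (J : R),
    [/\ range (interp_inj Hs (-1)) (interp_inj Hs delta (xi omega)),
       interp_inj Hs (-1) z = interp_inj Hs delta (xi omega) -
         interp_dot b0 (xi omega) *: interp_injH Hs b0,
       X (t, omega) - interp_exp A t (xi omega) = (hdot b0 w * J) *: of_H Hs delta b0 &
       expR (- (lambda b0 + `|eta|) * t) * (1 - expR (- m * t)) * `|z| <= J]}.
  apply: filterS2 (conv t tT) ae_coord => omega [fk Xt] hc.
  have hae : {ae lebesgue_measure, forall s : R, `]0, t]%classic s ->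
      forall b, B b -> b != b0 ->
      interp_dot b (X (s, omega)) = expR (- lambda b * s) * interp_dot b (xi omega)}.
    (* Each coordinate has its own null set of times; countability of [B] merges them into one. *)
    have : {ae lebesgue_measure, forall s : R, forall b, B b -> b != b0 -> `]0, T]%classic s ->
        interp_dot b (X (s, omega)) = expR (- lambda b * s) * interp_dot b (xi omega)}.
      apply: ae_forall_countable => // b Bb.
      have [->|bb0] := eqVneq b b0; first by apply: aeW.
      by apply: (@filterS _ _ (ae_filter_ringOfSetsType lebesgue_measure)
        _ _ _ (hc b Bb bb0)) => s h _.
    apply: (@filterS _ _ (ae_filter_ringOfSetsType lebesgue_measure)) => s h sD b Bb bb0.
    apply: h => //.
    by move: sD; rewrite /= !in_itv/= => /andP[-> /le_trans]; apply.
  have [z [rz zE low]] := mild_lower_bound hB cB eps0 heps hAb hb0 (mX omega)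
    (fun t tT => hXH t omega tT) tT m0 hm hae fk.
  exists z; eexists; split; [exact: rz|exact: zE| |exact: low].
  by rewrite Xt addrC addKr.
split; last first.
  apply: filterS good => omega [z [J [_ zE YE low]]] /=.
  (* Both infima in [norm_along] are attained, at [z] and at a multiple of the unit vector [b0],
     which leaves inequalities between real numbers. *)
  rewrite -zE YE norm_alongE; last exact: interp_inj_injective.
  rewrite linearZ/= e0E -linearZ/= norm_alongE; last exact: interp_injH_injective.
  rewrite (interp_dotZ hB eps0 epsS)// (interp_dot_H hB eps0 epsS hb0 e0E).
  have b01 : hdot b0 b0 = 1 by rewrite onB// eqxx.
  split; rewrite ?ltry//.
    by rewrite -EFinM lee_fin b01 mulr1 -!mulrA ler_wpM2l ?(ltW hw0)// mulrA.
  have nb0 : `|b0| = 1.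
    by apply/eqP; rewrite -(@pexpr_eq1 _ _ 2)// -hdotE b01.
  by rewrite lee_fin b01 normrZ nb0 !mulr1 ler_norm.
apply: ae_probability1; last by apply: filterS good => omega [z [J []]].
(* [good] only makes the complement negligible; probability 1 also needs the event to be measurable.
   It says that the H_(-1) coordinates of [xi] are square summable, and the series is measurable
   because [B] is countable. *)
pose c b omega := (hdot b (S b) `^ (-1) * interp_dot b (xi omega)) ^+ 2.
have mc : measurable_fun setT (fun omega => \esum_(b in B) (c b omega)%:E)%E.
  apply: measurable_esum => // [b Bb|b omega]; last exact: sqr_ge0.
  by apply: measurable_funX; apply: measurable_funM => //; exact: mxi.
rewrite (_ : [set _ | _] =
    setT `&` (fun omega => \esum_(b in B) (c b omega)%:E)%E @^-1` (~` [set +oo%E])).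
  by apply: mc => //; apply: measurableC; exact: emeasurable_set1.
rewrite setTI; apply/seteqP; split=> omega /=.
  move=> [x _ xE] /eqP; rewrite -leye_eq leNgt => /negP; apply.
  apply/esum_ltyP; exists (`|x| ^+ 2) => C BC.
  apply: le_trans (interp_bessel hB eps0 epsS x BC); have [_ CB] := BC.
  rewrite le_eqVlt; apply/orP; left; apply/eqP/eq_fsbigr => b /set_mem /CB Bb.
  by rewrite (interp_dot_nested hB eps0 epsS Bb xE).
move=> /eqP; rewrite -ltey => /esum_ltyP[M hM].
have [x hx] := interp_riesz_fischer hB eps0 epsS Hs hM.
by exists x => //; exact: (interp_dot_nested_inj hB eps0 epsS).
Qed.
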